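(* Let $A$ be an (associative, unital) algebra over a field $K$ of characteristic zero and let $s\ge 1$ be an integer. The following statements are equivalent. (1) There exist commuting locally nilpotent nonzero $K$-derivations $\delta_1,\dots,\delta_s$ of $A$ with generic kernels $C_i=\ker\delta_i$ satisfying $\bigcap_{i=1}^s C_i=K$. (2) $A$ is an iterated Ore extension $A=K[x_1][x_2;d_2][x_3;d_3]\cdots[x_s;d_s]$ such that $\lambda_{ij}:=d_i(x_j)\in K$ for all $i>j$, and there are $K$-derivations $\delta_1,\dots,\delta_s$ of $A$ with $\delta_i(x_j)=\delta_{ij}$ (Kronecker delta). (3) $A$ is isomorphic to a tensor product $A_n\otimes_K P_m$ of a Weyl algebra $A_n$ with a polynomial algebra $P_m$ in $m$ indeterminates, for some $n,m\ge0$ with $2n+m=s$. Suppose that these equivalent conditions hold, and let $\delta_1,\dots,\delta_s$ and $x_1,\dots,x_s$ be as in (1) and (2) with $\delta_i(x_j)=\delta_{ij}$ for all $i,j$. Then: (a) the elements $x_1,\dots,x_s$ are uniquely determined (by $\delta_1,\dots,\delta_s$) up to addition of scalars from $K$; (b) in (3), $n=\frac12\operatorname{rk}(\Lambda)$ and $m=s-2n=\dim\ker(\Lambda)$, where $\Lambda=(\lambda_{ij})$ is the antisymmetric $s\times s$ matrix with lower diagonal entries $\lambda_{ij}$ ($i>j$) as in (2); (c) for each $i$, the algebra $C_i=\ker\delta_i$ is an iterated Ore extension $K[x_1][x_2;d_2]\cdots[x_{i-1};d_{i-1}][x_{i+1};d_{i+1}]\cdots[x_s;d_s]$ with $d_k(x_j)=\lambda_{kj}$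 as in (2); hence $C_i\simeq A_{m_i}\otimes P_{l_i}$ for some $m_i,l_i$ with $2m_i+l_i=s-1$; (d) the Gelfand–Kirillov dimension of $A$ is $\mathrm{GK}(A)=s$.
   Context: A $K$-derivation $\delta$ of $A$ is locally nilpotent if for each $a\in A$ there is $k$ with $\delta^k(a)=0$. Derivations $\delta_1,\dots,\delta_s$ of $A$ have generic kernels if the intersections $\bigcap_{i\in I}\ker\delta_i$, $I\subseteq\{1,\dots,s\}$, are pairwise distinct for distinct $I$ (the empty intersection being $A$). For a ring $R$ with derivation $d$, the Ore extension $R[x;d]$ is the ring generated freely over $R$ by $x$ subject to $xr=rx+d(r)$ for $r\in R$; it is a free left and right $R$-module on the powers of $x$. In an iterated Ore extension, $d_i$ is a $K$-derivation of $K[x_1][x_2;d_2]\cdots[x_{i-1};d_{i-1}]$ (and in (c) of the corresponding subalgebra). The $n$-th Weyl algebra $A_n$ is the $K$-algebra generated by $q_1,\dots,q_n,p_1,\dots,p_n$ subject to $[p_i,q_j]=\delta_{ij}$, $[p_i,p_j]=[q_i,q_j]=0$; $A_0=P_0=K$. *)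

(* Defs.v *)
From HB Require Import structures.
From mathcomp Require Import all_boot all_order all_algebra.
From mathcomp Require Import generic_quotient mpoly.
From mathcomp Require Import boolp classical_sets reals ereal sequences exp.

Set Implicit Arguments.
Unset Strict Implicit.
Unset Printing Implicit Defensive.

Import Order.TTheory GRing.Theory Num.Theory.
Local Open Scope ring_scope.
Local Open Scope quotient_scope.

Inductive expr (K X : Type) : Type :=
| ECst of K
| EGen of X
| EAdd of expr K X & expr K X
| EMul of expr K X & expr K X.

Arguments ECst {K X}.
Arguments EGen {K X}.

HB.instance Definition _ (K X : Type) := gen_eqMixin (expr K X).
HB.instance Definition _ (K X : Type) := gen_choiceMixin (expr K X).

Section Presented.
Variables (K : fieldType) (X : Type) (rel : expr K X -> expr K X -> Prop).

(* The least congruence containing the relations for which the expressions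
   form a ring with a central copy of K. *)
Inductive pres_eq : expr K X -> expr K X -> Prop :=
| pres_rel t u : rel t u -> pres_eq t u
| pres_refl t : pres_eq t t
| pres_sym t u : pres_eq t u -> pres_eq u t
| pres_trans t u v : pres_eq t u -> pres_eq u v -> pres_eq t v
| pres_add t t' u u' :
    pres_eq t t' -> pres_eq u u' -> pres_eq (EAdd t u) (EAdd t' u')
| pres_mul t t' u u' :
    pres_eq t t' -> pres_eq u u' -> pres_eq (EMul t u) (EMul t' u')
| pres_addA t u v : pres_eq (EAdd t (EAdd u v)) (EAdd (EAdd t u) v)
| pres_addC t u : pres_eq (EAdd t u) (EAdd u t)
| pres_add0 t : pres_eq (EAdd (ECst 0) t) t
| pres_mulA t u v : pres_eq (EMul t (EMul u v)) (EMul (EMul t u) v)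
| pres_mul1 t : pres_eq (EMul (ECst 1) t) t
| pres_mulDl t u v :
    pres_eq (EMul (EAdd t u) v) (EAdd (EMul t v) (EMul u v))
| pres_mulDr t u v :
    pres_eq (EMul t (EAdd u v)) (EAdd (EMul t u) (EMul t v))
| pres_cst0 t : pres_eq (EMul (ECst 0) t) (ECst 0)
| pres_cstD a b : pres_eq (EAdd (ECst a) (ECst b)) (ECst (a + b))
| pres_cstM a b : pres_eq (EMul (ECst a) (ECst b)) (ECst (a * b))
| pres_cstC a t : pres_eq (EMul (ECst a) t) (EMul t (ECst a)).

Definition pres_eqb : ssrbool.rel (expr K X) := fun t u => `[< pres_eq t u >].

Lemma pres_eqb_refl : reflexive pres_eqb.
Proof. by move=> t; apply/asboolP; exact: pres_refl. Qed.

Lemma pres_eqb_sym : ssrbool.symmetric pres_eqb.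
Proof. by move=> t u; apply/asboolP/asboolP; exact: pres_sym. Qed.

Lemma pres_eqb_trans : transitive pres_eqb.
Proof.
move=> u t v /asboolP tu /asboolP uv; apply/asboolP; exact: pres_trans tu uv.
Qed.

Canonical pres_equiv :=
  EquivRel pres_eqb pres_eqb_refl pres_eqb_sym pres_eqb_trans.

Definition presented : Type := {eq_quot pres_equiv}.

HB.instance Definition _ := Choice.on presented.

Definition pres_class (t : expr K X) : presented := \pi_({eq_quot pres_equiv}) t.

Definition pres_gen (x : X) : presented := pres_class (EGen x).

Definition pres_repr (a : presented) : expr K X :=
  repr (a : {eq_quot pres_equiv}).

Lemma pres_reprK (a : presented) : pres_class (pres_repr a) = a.
Proof. exact: (@reprK _ {eq_quot pres_equiv}). Qed.

Lemma pres_classP t u : pres_class t = pres_class u <-> pres_eq t u.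
Proof.
split=> [/eqmodP/asboolP // | tu].
by apply/eqmodP/asboolP.
Qed.

Lemma pres_repr_class t : pres_eq (pres_repr (pres_class t)) t.
Proof. by apply/pres_classP; rewrite pres_reprK. Qed.

Definition pres_addf (a b : presented) : presented :=
  pres_class (EAdd (pres_repr a) (pres_repr b)).
Definition pres_mulf (a b : presented) : presented :=
  pres_class (EMul (pres_repr a) (pres_repr b)).
Definition pres_scalef (k : K) (a : presented) : presented :=
  pres_class (EMul (ECst k) (pres_repr a)).
Definition pres_oppf (a : presented) : presented := pres_scalef (-1) a.

Lemma pres_addfE t u :
  pres_addf (pres_class t) (pres_class u) = pres_class (EAdd t u).
Proof. by apply/pres_classP; apply: pres_add; exact: pres_repr_class. Qed.

Lemma pres_mulfE t u :
  pres_mulf (pres_class t) (pres_class u) = pres_class (EMul t u).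
Proof. by apply/pres_classP; apply: pres_mul; exact: pres_repr_class. Qed.

Lemma pres_scalefE k t :
  pres_scalef k (pres_class t) = pres_class (EMul (ECst k) t).
Proof.
apply/pres_classP; apply: pres_mul; [exact: pres_refl|exact: pres_repr_class].
Qed.

Lemma pres_oppfE t : pres_oppf (pres_class t) = pres_class (EMul (ECst (-1)) t).
Proof. exact: pres_scalefE. Qed.

Let presE := (pres_addfE, pres_mulfE, pres_scalefE, pres_oppfE).

Lemma presW (P : presented -> Prop) :
  (forall t, P (pres_class t)) -> forall a, P a.
Proof. by move=> H a; rewrite -(pres_reprK a). Qed.

Fact pres_faddA : associative pres_addf.
Proof.
elim/presW=> t; elim/presW=> u; elim/presW=> v; rewrite !presE.
by apply/pres_classP; exact: pres_addA.
Qed.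

Fact pres_faddC : commutative pres_addf.
Proof.
elim/presW=> t; elim/presW=> u; rewrite !presE.
by apply/pres_classP; exact: pres_addC.
Qed.

Fact pres_fadd0 : left_id (pres_class (ECst 0)) pres_addf.
Proof.
by elim/presW=> t; rewrite !presE; apply/pres_classP; exact: pres_add0.
Qed.

Fact pres_scaleDl a b t :
  pres_eq (EMul (ECst (a + b)) t) (EAdd (EMul (ECst a) t) (EMul (ECst b) t)).
Proof.
apply: pres_trans (pres_mulDl _ _ _).
by apply: pres_mul; [apply: pres_sym; exact: pres_cstD|exact: pres_refl].
Qed.

Fact pres_faddN : left_inverse (pres_class (ECst 0)) pres_oppf pres_addf.
Proof.
elim/presW=> t; rewrite !presE; apply/pres_classP.
apply: (@pres_trans _ (EMul (ECst (-1 + 1)) t)); last first.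
  by rewrite addNr; exact: pres_cst0.
apply: pres_trans (pres_sym (pres_scaleDl _ _ _)).
by apply: pres_add; [exact: pres_refl|apply: pres_sym; exact: pres_mul1].
Qed.

HB.instance Definition _ := GRing.isZmodule.Build presented
  pres_faddA pres_faddC pres_fadd0 pres_faddN.

Fact pres_fmulA : associative pres_mulf.
Proof.
elim/presW=> t; elim/presW=> u; elim/presW=> v; rewrite !presE.
by apply/pres_classP; exact: pres_mulA.
Qed.

Fact pres_fmul1 : left_id (pres_class (ECst 1)) pres_mulf.
Proof.
by elim/presW=> t; rewrite !presE; apply/pres_classP; exact: pres_mul1.
Qed.

Fact pres_fmulr1 : right_id (pres_class (ECst 1)) pres_mulf.
Proof.
elim/presW=> t; rewrite !presE; apply/pres_classP.
by apply: pres_trans (pres_sym (pres_cstC _ _)) _; exact: pres_mul1.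
Qed.

Fact pres_fmulDl : left_distributive pres_mulf +%R.
Proof.
elim/presW=> t; elim/presW=> u; elim/presW=> v.
by rewrite /GRing.add /= !presE; apply/pres_classP; exact: pres_mulDl.
Qed.

Fact pres_fmulDr : right_distributive pres_mulf +%R.
Proof.
elim/presW=> t; elim/presW=> u; elim/presW=> v.
by rewrite /GRing.add /= !presE; apply/pres_classP; exact: pres_mulDr.
Qed.

HB.instance Definition _ := GRing.Zmodule_isPzRing.Build presented
  pres_fmulA pres_fmul1 pres_fmulr1 pres_fmulDl pres_fmulDr.

Fact pres_fscaleA a b v :
  pres_scalef a (pres_scalef b v) = pres_scalef (a * b) v.
Proof.
elim/presW: v => t; rewrite !presE; apply/pres_classP.
apply: pres_trans (pres_mulA _ _ _) _.
by apply: pres_mul; [exact: pres_cstM|exact: pres_refl].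
Qed.

Fact pres_fscale1 : left_id 1 pres_scalef.
Proof.
by elim/presW=> t; rewrite !presE; apply/pres_classP; exact: pres_mul1.
Qed.

Fact pres_fscaleDr : right_distributive pres_scalef +%R.
Proof.
move=> k; elim/presW=> t; elim/presW=> u.
by rewrite /GRing.add /= !presE; apply/pres_classP; exact: pres_mulDr.
Qed.

Fact pres_fscaleDl v : {morph pres_scalef^~ v : a b / a + b}.
Proof.
elim/presW: v => t a b; rewrite {2}/GRing.add /= !presE.
by apply/pres_classP; exact: pres_scaleDl.
Qed.

HB.instance Definition _ := GRing.Zmodule_isLmodule.Build K presented
  pres_fscaleA pres_fscale1 pres_fscaleDr pres_fscaleDl.

Lemma pres_scaleAl (k : K) (a b : presented) : k *: (a * b) = (k *: a) * b.
Proof.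
elim/presW: a => t; elim/presW: b => u.
rewrite /GRing.scale /GRing.mul /= !presE.
by apply/pres_classP; exact: pres_mulA.
Qed.

Lemma pres_scaleAr (k : K) (a b : presented) : k *: (a * b) = a * (k *: b).
Proof.
elim/presW: a => t; elim/presW: b => u.
rewrite /GRing.scale /GRing.mul /= !presE; apply/pres_classP.
apply: pres_trans (pres_mulA _ _ _) _.
apply: pres_trans (pres_sym (pres_mulA _ _ _)).
by apply: pres_mul; [exact: pres_cstC|exact: pres_refl].
Qed.

End Presented.

(* The generators q_i and p_i are [inl i] and [inr i]. *)
Inductive weyl_rel (K : fieldType) (n : nat) :
    expr K ('I_n + 'I_n) -> expr K ('I_n + 'I_n) -> Prop :=
| weyl_pq (i j : 'I_n) :
    weyl_rel (EMul (EGen (inr i)) (EGen (inl j)))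
             (EAdd (EMul (EGen (inl j)) (EGen (inr i))) (ECst (i == j)%:R))
| weyl_pp (i j : 'I_n) :
    weyl_rel (EMul (EGen (inr i)) (EGen (inr j)))
             (EMul (EGen (inr j)) (EGen (inr i)))
| weyl_qq (i j : 'I_n) :
    weyl_rel (EMul (EGen (inl i)) (EGen (inl j)))
             (EMul (EGen (inl j)) (EGen (inl i))).

Section Weyl.
Variables (K : fieldType) (n : nat).

Definition weyl : Type := presented (@weyl_rel K n).

HB.instance Definition _ := GRing.PzRing.on weyl.
HB.instance Definition _ := GRing.Lmodule.on weyl.

(* The action on polynomials by multiplications and partial derivatives, which
   is used only to see that the algebra is nonzero. *)
Fixpoint weyl_act (t : expr K ('I_n + 'I_n)) (p : {mpoly K[n]}) :
    {mpoly K[n]} :=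
  match t with
  | ECst c => c *: p
  | EGen (inl i) => 'X_i * p
  | EGen (inr i) => p^`M(i)
  | EAdd t u => weyl_act t p + weyl_act u p
  | EMul t u => weyl_act t (weyl_act u p)
  end.

Fact weyl_act_lin t : linear (weyl_act t).
Proof.
elim: t => [c|[i|i]|t IHt u IHu|t IHt u IHu] k p q //=.
- by rewrite scalerDr !scalerA mulrC.
- by rewrite mulrDr scalerAr.
- by rewrite mderivD mderivZ.
- by rewrite IHt IHu scalerDr addrACA.
- by rewrite IHu IHt.
Qed.

Fact weyl_act_eq t u : pres_eq (@weyl_rel K n) t u -> weyl_act t =1 weyl_act u.
Proof.
have actD t0 : {morph weyl_act t0 : p q / p + q}.
  by move=> p q; have := weyl_act_lin t0 1 p q; rewrite !scale1r.
have act0 t0 : weyl_act t0 0 = 0.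
  by apply: (addrI (weyl_act t0 0)); rewrite -actD !addr0.
have actZ t0 k p : weyl_act t0 (k *: p) = k *: weyl_act t0 p.
  by have := weyl_act_lin t0 k p 0; rewrite act0 !addr0.
elim=> {t u} //=.
- move=> t u []{t u} i j p /=.
  + rewrite mderivM mderivX mnm1E addrC eq_sym.
    congr (_ + _); case: eqVneq => [->|_]; last by rewrite scale0r mul0r scale0r.
    suff -> : (U_(j) - U_(j) = 0)%MM.
      by rewrite mpolyX0 scale1r mul1r scale1r.
    by apply/mnmP => k; rewrite mnmBE subnn mnm0E.
  + exact: mderiv_comm.
  + exact: mulrCA.
- by move=> t u _ tu p; rewrite tu.
- by move=> t u v _ tu _ uv p; rewrite tu uv.
- by move=> t t' u u' _ tt' _ uu' p; rewrite tt' uu'.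
- by move=> t t' u u' _ tt' _ uu' p; rewrite uu' tt'.
- by move=> t u v p; rewrite addrA.
- by move=> t u p; rewrite addrC.
- by move=> t p; rewrite scale0r add0r.
- by move=> t p; rewrite scale1r.
- by move=> t u v p; rewrite actD.
- by move=> t p; rewrite !scale0r.
- by move=> a b p; rewrite scalerDl.
- by move=> a b p; rewrite scalerA.
- by move=> a t p; rewrite actZ.
Qed.

Fact weyl_oner_neq0 : (1 : weyl) != 0.
Proof.
apply/eqP => /pres_classP/weyl_act_eq/(_ 1)/eqP /=.
by rewrite scale1r scale0r oner_eq0.
Qed.

HB.instance Definition _ :=
  GRing.PzSemiRing_isNonZero.Build weyl weyl_oner_neq0.
HB.instance Definition _ :=
  GRing.Lmodule_isLalgebra.Build K weyl (@pres_scaleAl K _ (@weyl_rel K n)).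
HB.instance Definition _ :=
  GRing.Lalgebra_isAlgebra.Build K weyl (@pres_scaleAr K _ (@weyl_rel K n)).

End Weyl.

(* Formal linear combinations of pure tensors. *)
Inductive texpr (K B C : Type) : Type :=
| TPure of B & C
| TZero
| TAdd of texpr K B C & texpr K B C
| TScale of K & texpr K B C.

Arguments TPure {K B C}.
Arguments TZero {K B C}.

HB.instance Definition _ (K B C : Type) := gen_eqMixin (texpr K B C).
HB.instance Definition _ (K B C : Type) := gen_choiceMixin (texpr K B C).

Section Tensor.
Variables (K : fieldType) (B C : algType K).

(* The least congruence for which the expressions form a K-module and
   [TPure] is bilinear. *)
Inductive tens_eq : texpr K B C -> texpr K B C -> Prop :=
| tens_refl t : tens_eq t t
| tens_sym t u : tens_eq t u -> tens_eq u t
| tens_trans t u v : tens_eq t u -> tens_eq u v -> tens_eq t v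
| tens_add t t' u u' :
    tens_eq t t' -> tens_eq u u' -> tens_eq (TAdd t u) (TAdd t' u')
| tens_scale k t t' : tens_eq t t' -> tens_eq (TScale k t) (TScale k t')
| tens_addA t u v : tens_eq (TAdd t (TAdd u v)) (TAdd (TAdd t u) v)
| tens_addC t u : tens_eq (TAdd t u) (TAdd u t)
| tens_add0 t : tens_eq (TAdd TZero t) t
| tens_addN t : tens_eq (TAdd (TScale (-1) t) t) TZero
| tens_scaleA a b t : tens_eq (TScale a (TScale b t)) (TScale (a * b) t)
| tens_scale1 t : tens_eq (TScale 1 t) t
| tens_scaleDr k t u :
    tens_eq (TScale k (TAdd t u)) (TAdd (TScale k t) (TScale k u))
| tens_scaleDl a b t :
    tens_eq (TScale (a + b) t) (TAdd (TScale a t) (TScale b t))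
| tens_pureDl b b' c :
    tens_eq (TPure (b + b') c) (TAdd (TPure b c) (TPure b' c))
| tens_pureDr b c c' :
    tens_eq (TPure b (c + c')) (TAdd (TPure b c) (TPure b c'))
| tens_pureZl k b c : tens_eq (TPure (k *: b) c) (TScale k (TPure b c))
| tens_pureZr k b c : tens_eq (TPure b (k *: c)) (TScale k (TPure b c)).

Definition tens_eqb : ssrbool.rel (texpr K B C) :=
  fun t u => `[< tens_eq t u >].

Lemma tens_eqb_refl : reflexive tens_eqb.
Proof. by move=> t; apply/asboolP; exact: tens_refl. Qed.

Lemma tens_eqb_sym : ssrbool.symmetric tens_eqb.
Proof. by move=> t u; apply/asboolP/asboolP; exact: tens_sym. Qed.

Lemma tens_eqb_trans : transitive tens_eqb.
Proof.
move=> u t v /asboolP tu /asboolP uv; apply/asboolP; exact: tens_trans tu uv.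
Qed.

Canonical tens_equiv :=
  EquivRel tens_eqb tens_eqb_refl tens_eqb_sym tens_eqb_trans.

Definition tensor : Type := {eq_quot tens_equiv}.

HB.instance Definition _ := Choice.on tensor.

Definition tens_class (t : texpr K B C) : tensor := \pi_({eq_quot tens_equiv}) t.

Definition tens_repr (a : tensor) : texpr K B C :=
  repr (a : {eq_quot tens_equiv}).

Definition pure_tensor (b : B) (c : C) : tensor := tens_class (TPure b c).

Lemma tens_reprK (a : tensor) : tens_class (tens_repr a) = a.
Proof. exact: (@reprK _ {eq_quot tens_equiv}). Qed.

Lemma tens_classP t u : tens_class t = tens_class u <-> tens_eq t u.
Proof.
split=> [/eqmodP/asboolP // | tu].
by apply/eqmodP/asboolP.
Qed.

Lemma tens_repr_class t : tens_eq (tens_repr (tens_class t)) t.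
Proof. by apply/tens_classP; rewrite tens_reprK. Qed.

Lemma tensW (P : tensor -> Prop) : (forall t, P (tens_class t)) -> forall a, P a.
Proof. by move=> H a; rewrite -(tens_reprK a). Qed.

Definition tens_addf (a b : tensor) : tensor :=
  tens_class (TAdd (tens_repr a) (tens_repr b)).
Definition tens_scalef (k : K) (a : tensor) : tensor :=
  tens_class (TScale k (tens_repr a)).
Definition tens_oppf (a : tensor) : tensor := tens_scalef (-1) a.

Lemma tens_addfE t u :
  tens_addf (tens_class t) (tens_class u) = tens_class (TAdd t u).
Proof. by apply/tens_classP; apply: tens_add; exact: tens_repr_class. Qed.

Lemma tens_scalefE k t :
  tens_scalef k (tens_class t) = tens_class (TScale k t).
Proof. by apply/tens_classP; apply: tens_scale; exact: tens_repr_class. Qed.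

Lemma tens_oppfE t : tens_oppf (tens_class t) = tens_class (TScale (-1) t).
Proof. exact: tens_scalefE. Qed.

Let tensE := (tens_addfE, tens_scalefE, tens_oppfE).

Fact tens_faddA : associative tens_addf.
Proof.
elim/tensW=> t; elim/tensW=> u; elim/tensW=> v; rewrite !tensE.
by apply/tens_classP; exact: tens_addA.
Qed.

Fact tens_faddC : commutative tens_addf.
Proof.
elim/tensW=> t; elim/tensW=> u; rewrite !tensE.
by apply/tens_classP; exact: tens_addC.
Qed.

Fact tens_fadd0 : left_id (tens_class TZero) tens_addf.
Proof.
by elim/tensW=> t; rewrite !tensE; apply/tens_classP; exact: tens_add0.
Qed.

Fact tens_faddN : left_inverse (tens_class TZero) tens_oppf tens_addf.
Proof.
by elim/tensW=> t; rewrite !tensE; apply/tens_classP; exact: tens_addN.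
Qed.

HB.instance Definition _ := GRing.isZmodule.Build tensor
  tens_faddA tens_faddC tens_fadd0 tens_faddN.

Fact tens_fscaleA a b v :
  tens_scalef a (tens_scalef b v) = tens_scalef (a * b) v.
Proof.
by elim/tensW: v => t; rewrite !tensE; apply/tens_classP; exact: tens_scaleA.
Qed.

Fact tens_fscale1 : left_id 1 tens_scalef.
Proof.
by elim/tensW=> t; rewrite !tensE; apply/tens_classP; exact: tens_scale1.
Qed.

Fact tens_fscaleDr : right_distributive tens_scalef +%R.
Proof.
move=> k; elim/tensW=> t; elim/tensW=> u.
by rewrite /GRing.add /= !tensE; apply/tens_classP; exact: tens_scaleDr.
Qed.

Fact tens_fscaleDl v : {morph tens_scalef^~ v : a b / a + b}.
Proof.
elim/tensW: v => t a b; rewrite {2}/GRing.add /= !tensE.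
by apply/tens_classP; exact: tens_scaleDl.
Qed.

HB.instance Definition _ := GRing.Zmodule_isLmodule.Build K tensor
  tens_fscaleA tens_fscale1 tens_fscaleDr tens_fscaleDl.

Lemma tens_classD t u : tens_class (TAdd t u) = tens_class t + tens_class u.
Proof. by rewrite /GRing.add /= tensE. Qed.

Lemma tens_classZ k t : tens_class (TScale k t) = k *: tens_class t.
Proof. by rewrite /GRing.scale /= tensE. Qed.

Lemma tens_class0 : tens_class TZero = 0.
Proof. by []. Qed.

Let classE := (tens_classD, tens_classZ, tens_class0).

(* The product is determined by (b (x) c) (b' (x) c') = b b' (x) c c'. *)
Fixpoint tmul_pure (b : B) (c : C) (t : texpr K B C) : texpr K B C :=
  match t with
  | TPure b' c' => TPure (b * b') (c * c')
  | TZero => TZero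
  | TAdd t u => TAdd (tmul_pure b c t) (tmul_pure b c u)
  | TScale k t => TScale k (tmul_pure b c t)
  end.

Fixpoint tmul (t u : texpr K B C) : texpr K B C :=
  match t with
  | TPure b c => tmul_pure b c u
  | TZero => TZero
  | TAdd t t' => TAdd (tmul t u) (tmul t' u)
  | TScale k t => TScale k (tmul t u)
  end.

Lemma tmul_pure_eq b c t u :
  tens_eq t u -> tens_eq (tmul_pure b c t) (tmul_pure b c u).
Proof.
move=> tu; apply/tens_classP; elim: tu => {t u} //=.
- by move=> t u v _ -> _ ->.
- by move=> t t' u u' _ tt' _ uu'; rewrite !classE tt' uu'.
- by move=> k t t' _ tt'; rewrite !classE tt'.
- by move=> t u v; rewrite !classE addrA.
- by move=> t u; rewrite !classE addrC.
- by move=> t; rewrite !classE add0r.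
- by move=> t; rewrite !classE scaleN1r addNr.
- by move=> a a' t; rewrite !classE scalerA.
- by move=> t; rewrite !classE scale1r.
- by move=> k t u; rewrite !classE scalerDr.
- by move=> a a' t; rewrite !classE scalerDl.
- by move=> *; rewrite mulrDr; apply/tens_classP; exact: tens_pureDl.
- by move=> *; rewrite mulrDr; apply/tens_classP; exact: tens_pureDr.
- by move=> *; rewrite -scalerAr; apply/tens_classP; exact: tens_pureZl.
- by move=> *; rewrite -scalerAr; apply/tens_classP; exact: tens_pureZr.
Qed.

Lemma tmul_pureDl b b' c t : tens_class (tmul_pure (b + b') c t) =
  tens_class (tmul_pure b c t) + tens_class (tmul_pure b' c t).
Proof.
elim: t => [x y||t IHt u IHu|k t IHt] /=; rewrite ?classE.
- by rewrite mulrDl -tens_classD; apply/tens_classP; exact: tens_pureDl.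
- by rewrite addr0.
- by rewrite IHt IHu addrACA.
- by rewrite IHt scalerDr.
Qed.

Lemma tmul_pureDr b c c' t : tens_class (tmul_pure b (c + c') t) =
  tens_class (tmul_pure b c t) + tens_class (tmul_pure b c' t).
Proof.
elim: t => [x y||t IHt u IHu|k t IHt] /=; rewrite ?classE.
- by rewrite mulrDl -tens_classD; apply/tens_classP; exact: tens_pureDr.
- by rewrite addr0.
- by rewrite IHt IHu addrACA.
- by rewrite IHt scalerDr.
Qed.

Lemma tmul_pureZl a b c t :
  tens_class (tmul_pure (a *: b) c t) = a *: tens_class (tmul_pure b c t).
Proof.
elim: t => [x y||t IHt u IHu|k t IHt] /=; rewrite ?classE.
- by rewrite -scalerAl -tens_classZ; apply/tens_classP; exact: tens_pureZl.
- by rewrite scaler0.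
- by rewrite IHt IHu scalerDr.
- by rewrite IHt !scalerA mulrC.
Qed.

Lemma tmul_pureZr a b c t :
  tens_class (tmul_pure b (a *: c) t) = a *: tens_class (tmul_pure b c t).
Proof.
elim: t => [x y||t IHt u IHu|k t IHt] /=; rewrite ?classE.
- by rewrite -scalerAl -tens_classZ; apply/tens_classP; exact: tens_pureZr.
- by rewrite scaler0.
- by rewrite IHt IHu scalerDr.
- by rewrite IHt !scalerA mulrC.
Qed.

Lemma tmul_eqr t u u' : tens_eq u u' -> tens_eq (tmul t u) (tmul t u').
Proof.
move=> uu'; apply/tens_classP; elim: t => [x y||t IHt v IHv|k t IHt] //=.
- by apply/tens_classP; exact: tmul_pure_eq.
- by rewrite !classE IHt IHv.
- by rewrite !classE IHt.
Qed.

Lemma tmul_eql t t' u : tens_eq t t' -> tens_eq (tmul t u) (tmul t' u).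
Proof.
move=> tt'; apply/tens_classP; elim: tt' => {t t'} //=.
- by move=> t t' t'' _ -> _ ->.
- by move=> t t' v v' _ tt' _ vv'; rewrite !classE tt' vv'.
- by move=> k t t' _ tt'; rewrite !classE tt'.
- by move=> t v w; rewrite !classE addrA.
- by move=> t v; rewrite !classE addrC.
- by move=> t; rewrite !classE add0r.
- by move=> t; rewrite !classE scaleN1r addNr.
- by move=> a a' t; rewrite !classE scalerA.
- by move=> t; rewrite !classE scale1r.
- by move=> k t v; rewrite !classE scalerDr.
- by move=> a a' t; rewrite !classE scalerDl.
- by move=> *; rewrite classE tmul_pureDl.
- by move=> *; rewrite classE tmul_pureDr.
- by move=> *; rewrite classE tmul_pureZl.
- by move=> *; rewrite classE tmul_pureZr.
Qed.

Definition tens_mulf (a b : tensor) : tensor :=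
  tens_class (tmul (tens_repr a) (tens_repr b)).

Lemma tens_mulfE t u :
  tens_mulf (tens_class t) (tens_class u) = tens_class (tmul t u).
Proof.
apply/tens_classP.
apply: (tens_trans (tmul_eql _ (tens_repr_class t))).
exact: tmul_eqr (tens_repr_class u).
Qed.

Fact tens_fmulDl : left_distributive tens_mulf +%R.
Proof.
elim/tensW=> t; elim/tensW=> u; elim/tensW=> v.
by rewrite -tens_classD !tens_mulfE /= tens_classD.
Qed.

Fact tens_fmulDr : right_distributive tens_mulf +%R.
Proof.
elim/tensW=> t; elim/tensW=> u; elim/tensW=> v; rewrite -tens_classD !tens_mulfE.
elim: t => [x y||t IHt w IHw|k t IHt] /=; rewrite !classE //.
- by rewrite addr0.
- by rewrite IHt IHw addrACA.
- by rewrite IHt scalerDr.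
Qed.

Fact tens_fscaleAl k a b :
  tens_scalef k (tens_mulf a b) = tens_mulf (tens_scalef k a) b.
Proof.
by elim/tensW: a => t; elim/tensW: b => u; rewrite !(tensE, tens_mulfE).
Qed.

Fact tens_fscaleAr k a b :
  tens_scalef k (tens_mulf a b) = tens_mulf a (tens_scalef k b).
Proof.
elim/tensW: a => t; elim/tensW: b => u; rewrite !(tensE, tens_mulfE) classE.
elim: t => [x y||t IHt w IHw|l t IHt] /=; rewrite !classE //.
- by rewrite scaler0.
- by rewrite scalerDr IHt IHw.
- by rewrite -IHt !scalerA mulrC.
Qed.

Fact tens_fmulA : associative tens_mulf.
Proof.
elim/tensW=> t; elim/tensW=> u; elim/tensW=> v; rewrite !tens_mulfE.
elim: t => [x y||t IHt w IHw|k t IHt] /=; rewrite ?classE //.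
- elim: u => [x' y'||u IHu w IHw|k u IHu] /=; rewrite ?classE //.
  + elim: v => [x'' y''||v IHv w IHw|k v IHv] /=; rewrite ?classE ?mulrA //.
      by rewrite IHv IHw.
    by rewrite IHv.
  + by rewrite IHu IHw.
  + by rewrite IHu.
- by rewrite IHt IHw.
- by rewrite IHt.
Qed.

Fact tens_fmul1 : left_id (pure_tensor 1 1) tens_mulf.
Proof.
elim/tensW=> t; rewrite tens_mulfE /=.
elim: t => [x y||t IHt w IHw|k t IHt] /=; rewrite ?classE ?mul1r //.
  by rewrite IHt IHw.
by rewrite IHt.
Qed.

Fact tens_fmulr1 : right_id (pure_tensor 1 1) tens_mulf.
Proof.
elim/tensW=> t; rewrite tens_mulfE.
elim: t => [x y||t IHt w IHw|k t IHt] /=; rewrite ?classE ?mulr1 //.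
  by rewrite IHt IHw.
by rewrite IHt.
Qed.

HB.instance Definition _ := GRing.Zmodule_isPzRing.Build tensor
  tens_fmulA tens_fmul1 tens_fmulr1 tens_fmulDl tens_fmulDr.

Lemma tens_scaleAl (k : K) (a b : tensor) : k *: (a * b) = (k *: a) * b.
Proof. exact: tens_fscaleAl. Qed.

Lemma tens_scaleAr (k : K) (a b : tensor) : k *: (a * b) = a * (k *: b).
Proof. exact: tens_fscaleAr. Qed.

End Tensor.

Local Open Scope classical_set_scope.

Section Notions.
Variables (K : fieldType) (A : algType K).
Implicit Types (R S : set A) (d : A -> A) (x : A).

Definition scalars : set A := range (fun c : K => c%:A).

Definition kderivation d : Prop :=
  linear d /\ forall a b, d (a * b) = d a * b + a * d b.

Definition loc_nilpotent d : Prop := forall a, exists k, iter k d a = 0.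

Definition derker d : set A := [set a | d a = 0].

Definition generic_kernels (s : nat) (delta : 'I_s -> A -> A) : Prop :=
  injective (fun I : {set 'I_s} => \bigcap_(i in [set` I]) derker (delta i)).

Record lnd_family (s : nat) (delta : 'I_s -> A -> A) : Prop := {
  lnd_der : forall i, kderivation (delta i);
  lnd_nilp : forall i, loc_nilpotent (delta i);
  lnd_neq0 : forall i, exists a, delta i a != 0;
  lnd_comm : forall i j a, delta i (delta j a) = delta j (delta i a);
  lnd_generic : generic_kernels delta;
  lnd_cap : \bigcap_i derker (delta i) = scalars
}.

Definition kronecker (s : nat) (delta : 'I_s -> A -> A) (x : 'I_s -> A) : Prop :=
  forall i j, delta i (x j) = (i == j)%:R.

Definition subalgebra R : Prop :=
  [/\ R 1, forall a b, R a -> R b -> R (a + b),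
      forall a b, R a -> R b -> R (a * b) &
      forall (k : K) a, R a -> R (k *: a)].

(* [d] is a K-derivation of the subalgebra [R]; its values outside of [R] are
   irrelevant. *)
Definition kderivation_on R d : Prop :=
  [/\ forall a, R a -> R (d a),
      forall (k : K) a b, R a -> R b -> d (k *: a + b) = k *: d a + d b &
      forall a b, R a -> R b -> d (a * b) = d a * b + a * d b].

(* R[X; d] is generated by a copy [Some r] of R and by X = [None].  Presenting
   it as a K-algebra rather than as a ring makes no difference: the
   K-derivation d kills K, so the scalars commute with X. *)
Inductive ore_rel R d :
    expr K (option {r : A | R r}) -> expr K (option {r : A | R r}) -> Prop :=
| ore_scalar (k : K) (r : {r : A | R r}) :
    sval r = k%:A -> ore_rel d (EGen (Some r)) (ECst k)
| ore_add (r1 r2 r : {r : A | R r}) :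
    sval r = sval r1 + sval r2 ->
    ore_rel d (EGen (Some r)) (EAdd (EGen (Some r1)) (EGen (Some r2)))
| ore_mul (r1 r2 r : {r : A | R r}) :
    sval r = sval r1 * sval r2 ->
    ore_rel d (EGen (Some r)) (EMul (EGen (Some r1)) (EGen (Some r2)))
| ore_comm (r r' : {r : A | R r}) :
    sval r' = d (sval r) ->
    ore_rel d (EMul (EGen None) (EGen (Some r)))
              (EAdd (EMul (EGen (Some r)) (EGen None)) (EGen (Some r'))).

Definition ore_ext R d : Type := presented (@ore_rel R d).

HB.instance Definition _ R d := GRing.PzRing.on (ore_ext R d).
HB.instance Definition _ R d := GRing.Lmodule.on (ore_ext R d).

Definition ore_coef R d (r : {r : A | R r}) : ore_ext R d :=
  pres_gen (@ore_rel R d) (Some r).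
Definition ore_var R d : ore_ext R d := pres_gen (@ore_rel R d) None.

(* S = R[x; d] as subalgebras of A. *)
Definition is_ore_ext R x d S : Prop :=
  [/\ subalgebra R, kderivation_on R d &
      exists f : ore_ext R d -> A,
        [/\ linear f /\ monoid_morphism f,
            forall r : {r : A | R r}, f (ore_coef d r) = sval r,
            f (ore_var R d) = x,
            injective f &
            range f = S]].

(* S = R[x_i1; d_i1][x_i2; d_i2]... for the list i1, i2, ... of indices. *)
Fixpoint is_iter_ore (I : Type) (x : I -> A) (d : I -> A -> A) R (l : seq I) S :
    Prop :=
  if l is i :: l' then
    exists R', is_ore_ext R (x i) (d i) R' /\ is_iter_ore x d R' l' S
  else S = R.

(* S = K[x_i1][x_i2; d_i2]... with d_i(x_j) = lambda_ij for i > j.  The first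
   extension is the polynomial ring K[x_i1]: d_i1 restricts to a K-derivation
   of K, that is, to 0. *)
Definition scalar_iter_ore (s : nat) (x : 'I_s -> A) (d : 'I_s -> A -> A)
    (lambda : 'I_s -> 'I_s -> K) (l : seq 'I_s) S : Prop :=
  is_iter_ore x d scalars l S /\
  forall i j, i \in l -> j \in l -> (j < i)%N -> d i (x j) = (lambda i j)%:A.

Definition antisym_mx (s : nat) (lambda : 'I_s -> 'I_s -> K) : 'M[K]_s :=
  \matrix_(i, j) if (j < i)%N then lambda i j
                 else if (i < j)%N then - lambda j i else 0.

(* The subalgebra S is isomorphic to A_n (x) P_m. *)
Definition iso_weyl_poly (n m : nat) S : Prop :=
  exists f : tensor (weyl K n) {mpoly K[m]} -> A,
    [/\ linear f, monoid_morphism f, injective f & range f = S].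

(* The products of at most [n] elements of [v]; they span V^0 + ... + V^n,
   where V is the span of [v]. *)
Fixpoint words (v : seq A) (n : nat) : seq A :=
  if n is n'.+1 then words v n' ++ [seq a * b | a <- v, b <- words v n']
  else [:: 1].

(* The dimension of the span of [w]: the largest number of members of [w] that
   are linearly independent. *)
Definition dim_span (w : seq A) : nat :=
  \max_(J : {set 'I_(size w)} |
    `[< forall c : 'I_(size w) -> K,
          \sum_(i in J) c i *: w`_i = 0 -> forall i, i \in J -> c i = 0 >]) #|J|.

(* The supremum over the finite-dimensional subspaces V of A of
   limsup_n log_n dim (V^0 + ... + V^n). *)
Definition GKdim (RR : realType) : \bar RR :=
  ereal_sup [set limn_esup
    (fun n => (ln (dim_span (words v n))%:R / ln n%:R)%:E : \bar RR)
    | v in [set: seq A]].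

End Notions.

Arguments iso_weyl_poly {K A}.
Arguments GKdim {K} A RR.

Section Conditions.
Variables (K : fieldType) (A : algType K) (s : nat).

Definition ore_family (x : 'I_s -> A) (d : 'I_s -> A -> A)
    (lambda : 'I_s -> 'I_s -> K) (delta : 'I_s -> A -> A) : Prop :=
  [/\ scalar_iter_ore x d lambda (enum 'I_s) setT,
      forall i, kderivation (delta i) &
      kronecker delta x].

Definition cond_lnd : Prop := exists delta : 'I_s -> A -> A, lnd_family delta.

Definition cond_ore : Prop :=
  exists x d lambda delta, ore_family x d lambda delta.

Definition cond_weyl : Prop :=
  exists n m, (2 * n + m = s)%N /\ iso_weyl_poly n m [set: A].

End Conditions.

Arguments cond_lnd {K}.
Arguments cond_ore {K}.
Arguments cond_weyl {K}.

(* Main.v *)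
From HB Require Import structures.
Require Import Defs.
From mathcomp Require Import all_boot all_order all_algebra mpoly.
From mathcomp Require Import boolp classical_sets topology normedtype.
From mathcomp Require Import reals ereal sequences exp.

Set Implicit Arguments.
Unset Strict Implicit.
Unset Printing Implicit Defensive.

Import Order.TTheory GRing.Theory Num.Theory.
Local Open Scope ring_scope.
Local Open Scope classical_set_scope.

(** A family of coordinates for commuting derivations [delta_i] consists of
    elements [x_i] with [delta_i (x_j)] equal to 1 for [i = j] and to 0
    otherwise. All the conditions of the theorem amount to the existence of such
    coordinates that generate [A] and have scalar brackets [x_i x_j - x_j x_i].

    Locally nilpotent derivations with generic kernels have coordinates
    ([lnd_coordinates]), and their brackets are scalars because every derivation
    kills them. Taylor expansion in one variable at a time shows that adjoining
    [x_i] to the common constants of [delta_i] and some of the other derivations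
    gives the common constants of those other derivations, freely over the powers
    of [x_i] ([constants_step]). Adjoining all variables in increasing order
    presents [A] as an iterated Ore extension in which [d_i] is the bracket with
    [x_i]; leaving out one variable presents the kernel of its derivation
    ([constants_iter_ore]).

    Conversely, suppose that elements with scalar brackets generate an algebra.
    The ordered monomials in them span it, and if they have coordinate
    derivations, these eliminate the variables one by one. So the common kernel
    is [K] ([iter_ore_sum_ker], [lnd_of_generators]), and a morphism from an
    algebra with the same spanning monomials is injective ([iter_ore_sum_inj]).
    The latter gives the freeness of Ore extensions and the isomorphisms from
    [A_n (x) P_m] to algebras with standard coordinates ([weyl_poly_iso]).

    Linear changes of coordinates act on the bracket matrix by congruence. Its
    normal form ([darboux]) yields standard coordinates with [2 n] equal to the
    rank of the matrix ([coordinates_iso]). In [A_n (x) P_m] the brackets with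
    the [p_i] and [q_i] and the partial derivatives of [P_m] are coordinate
    derivations, which closes the circle of implications ([iso_weyl_poly_lnd]).
    They also show that the centre is [P_m]; since the number of central elements
    that admit coordinate derivations is bounded by a Jacobian argument
    ([iso_central_le]), [m] depends only on [A], and so does [n].

    Finally, the elements killed by [delta_i ^ N] for all [i] are the
    combinations of the monomials with exponents below [N], so they form a space
    of dimension [N ^ s]. These spaces multiply like a filtration, which bounds
    the growth of [A] from above, while the monomials bound it from below
    ([dim_words_le], [dim_words_ge]). *)

(** * Derivations and brackets *)

Section Derivations.
Variables (K : fieldType) (A : algType K).
Implicit Types (d : A -> A) (a b : A) (S : set A).

Lemma kder_lin d : kderivation d -> linear d. Proof. by case. Qed.
Lemma kderM d : kderivation d -> forall a b, d (a * b) = d a * b + a * d b.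
Proof. by case. Qed.

Lemma kderD d : kderivation d -> {morph d : a b / a + b}.
Proof. by move=> [dl _] a b; have := dl 1 a b; rewrite !scale1r. Qed.

Lemma kder0 d : kderivation d -> d 0 = 0.
Proof. by move=> dd; apply: (addrI (d 0)); rewrite -(kderD dd) !addr0. Qed.

Lemma kderZ d : kderivation d -> forall k, {morph d : a / k *: a}.
Proof. by move=> dd k a; rewrite -[k *: a]addr0 (kder_lin dd) (kder0 dd) addr0. Qed.

Lemma kderN d : kderivation d -> {morph d : a / - a}.
Proof. by move=> dd a; rewrite -scaleN1r (kderZ dd) scaleN1r. Qed.

Lemma kderB d : kderivation d -> {morph d : a b / a - b}.
Proof. by move=> dd a b; rewrite (kderD dd) kderN. Qed.

Lemma kder_sum d : kderivation d -> forall (I : Type) (r : seq I) (F : I -> A),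
  d (\sum_(i <- r) F i) = \sum_(i <- r) d (F i).
Proof. by move=> dd I r F; apply: (big_morph d (kderD dd) (kder0 dd)). Qed.

Lemma kder1 d : kderivation d -> d 1 = 0.
Proof.
move=> dd; apply: (addrI (d 1)).
by have := kderM dd 1 1; rewrite !mulr1 mul1r addr0.
Qed.

Lemma kder_scalar d (k : K) : kderivation d -> d k%:A = 0.
Proof. by move=> dd; rewrite (kderZ dd) (kder1 dd) scaler0. Qed.

Lemma kder_iter0 d n : kderivation d -> iter n d 0 = 0.
Proof. by move=> dd; elim: n => //= n ->; exact: kder0. Qed.

Lemma kder_iterD d n : kderivation d -> {morph iter n d : a b / a + b}.
Proof. by move=> dd a b; elim: n => //= n ->; exact: kderD. Qed.

Lemma kder_iterZ d n k : kderivation d -> {morph iter n d : a / k *: a}.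
Proof. by move=> dd a; elim: n => //= n ->; exact: kderZ. Qed.

(** By Leibniz, each term of [d^(m + n) (a b)] differentiates either [a] at
    least [m] times or [b] at least [n] times. *)
Lemma kder_iterM_eq0 d m n a b : kderivation d ->
  iter m d a = 0 -> iter n d b = 0 -> iter (m + n) d (a * b) = 0.
Proof.
move=> dd; move: {2}(m + n)%N (leqnn (m + n)) => N.
elim: N m n a b => [|N IH] m n a b.
  rewrite leqn0 addn_eq0 => /andP[/eqP -> /eqP ->] /= -> _.
  by rewrite mul0r.
case: m => [|m] mnN; first by move=> a0 _; rewrite [a]a0 mul0r kder_iter0.
case: n mnN => [|n] mnN; first by move=> _ b0; rewrite [b]b0 mulr0 kder_iter0.
move=> da db; rewrite addSn iterSr (kderM dd) kder_iterD //.
rewrite addSn ltnS in mnN.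
rewrite (IH m n.+1) -?iterSr // add0r -addSnnS.
by apply: IH; rewrite -?iterSr // addSnnS.
Qed.

Lemma kder_comb (I : finType) (d : I -> A -> A) (c : I -> K) :
  (forall i, kderivation (d i)) -> kderivation (fun a => \sum_i c i *: d i a).
Proof.
move=> dd; split=> [k a b | a b].
  rewrite scaler_sumr -big_split; apply: eq_bigr => i _ /=.
  by rewrite (kder_lin (dd i)) scalerDr !scalerA mulrC.
rewrite mulr_suml mulr_sumr -big_split; apply: eq_bigr => i _ /=.
by rewrite (kderM (dd i)) scalerDr scalerAl scalerAr.
Qed.

Definition bracket a b := a * b - b * a.

Lemma bracket_kder a : kderivation (bracket a).
Proof.
split=> [k b c | b c]; rewrite /bracket.
  by rewrite mulrDr mulrDl -scalerAl -scalerAr scalerBr addrACA -opprD.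
by rewrite mulrBl mulrBr -!mulrA addrA subrK.
Qed.

Lemma bracketC a b : bracket a b = - bracket b a.
Proof. by rewrite /bracket opprB. Qed.

Lemma kder_bracket d a b : kderivation d ->
  d (bracket a b) = bracket (d a) b + bracket a (d b).
Proof.
move=> dd; rewrite /bracket (kderB dd) !(kderM dd) [d b * a + _]addrC opprD addrACA.
by [].
Qed.

Lemma bracket_scalar a k : bracket a k%:A = 0.
Proof. by rewrite /bracket -scalerAr mulr1 -scalerAl mul1r subrr. Qed.

End Derivations.

(** * Polynomial expressions with coefficients on the left *)

Section OreSums.
Variable T : pzRingType.
Implicit Types (R S : set T) (x a b : T).

Definition subring R : Prop :=
  [/\ R 1, forall a b, R a -> R b -> R (a - b)
    & forall a b, R a -> R b -> R (a * b)].

Section Subring.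
Variables (R : set T) (Rr : subring R).
Lemma subring1 : R 1. Proof. by case: Rr. Qed.
Lemma subringB a b : R a -> R b -> R (a - b). Proof. by case: Rr => _ + _; apply. Qed.
Lemma subringM a b : R a -> R b -> R (a * b). Proof. by case: Rr => _ _; apply. Qed.
Lemma subring0 : R 0.
Proof. by rewrite -(subrr 1); apply: subringB subring1 subring1. Qed.
Lemma subringN a : R a -> R (- a).
Proof. by rewrite -sub0r; apply: subringB subring0. Qed.
Lemma subringD a b : R a -> R b -> R (a + b).
Proof. by move=> Ra Rb; rewrite -[b]opprK; apply/subringB/subringN. Qed.
End Subring.

(** The sums [r_0 + r_1 x + ... + r_n x^n], in Horner form: closure under the
    ring operations then goes by structural induction. *)
Inductive ore_sum R x : T -> Prop :=
| OreConst r : R r -> ore_sum R x r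
| OreHorner a r : ore_sum R x a -> R r -> ore_sum R x (a * x + r).

Section OreSumSubring.
Variables (R : set T) (x : T) (Rr : subring R).
Hypothesis Rx : forall r, R r -> R (x * r - r * x).

Lemma ore_sumD a b : ore_sum R x a -> ore_sum R x b -> ore_sum R x (a + b).
Proof.
move=> Sa; elim: Sa b => {a} [r Rr0 | a r Sa IH Rr0] b [r' Rr' | b' r' Sb' Rr'].
- by left; apply: subringD.
- by rewrite addrCA; right=> //; apply: subringD.
- by rewrite -addrA; right=> //; apply: subringD.
- by rewrite addrACA -mulrDl; right; [apply: IH | apply: subringD].
Qed.

Lemma ore_sumX a : ore_sum R x a -> ore_sum R x (a * x).
Proof. by move=> Sa; rewrite -[a * x]addr0; right=> //; apply: subring0. Qed.

Lemma ore_sumMl r a : R r -> ore_sum R x a -> ore_sum R x (r * a).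
Proof.
move=> Rr0; elim=> {a} [r' Rr' | a r' Sa IH Rr']; first by left; apply: subringM.
by rewrite mulrDr mulrA; right=> //; apply: subringM.
Qed.

(** Moving [r] to the left of [x] produces the bracket of [x] and [r], which is
    again a coefficient. *)
Lemma ore_sumMr r a : R r -> ore_sum R x a -> ore_sum R x (a * r).
Proof.
move=> + Sa; elim: Sa r => {a} [r' Rr' | a r' Sa IH Rr'] r Rr0.
  by left; apply: subringM.
rewrite mulrDl; apply: ore_sumD; last by left; apply: subringM.
have -> : a * x * r = a * (x * r - r * x) + a * r * x.
  by rewrite mulrBr !mulrA subrK.
by apply: ore_sumD; [apply/IH/Rx | apply/ore_sumX/IH].
Qed.

Lemma ore_sum_subring : subring (ore_sum R x).
Proof.
have SM a b : ore_sum R x a -> ore_sum R x b -> ore_sum R x (a * b).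
  move=> Sa; elim=> {b} [r Rr0 | b r Sb IH Rr0]; first exact: ore_sumMr.
  by rewrite mulrDr mulrA; apply: ore_sumD; [apply: ore_sumX | apply: ore_sumMr].
split=> // [|a b Sa Sb]; first by left; apply: subring1.
rewrite -mulN1r; apply: ore_sumD => //; apply: ore_sumMl => //.
exact/(subringN Rr)/(subring1 Rr).
Qed.

Lemma ore_sum_var : ore_sum R x x.
Proof. by rewrite -[X in ore_sum _ _ X]mul1r; apply: ore_sumX; left; apply: subring1. Qed.

Lemma ore_sum_coefs a :
  ore_sum R x a <->
  exists N (r : nat -> T), (forall i, R (r i)) /\ a = \sum_(i < N) r i * x ^+ i.
Proof.
split.
  elim=> {a} [r Rr0 | a r _ [N [c [Rc ->]]] Rr0].
    by exists 1%N, (fun=> r); split=> //; rewrite big_ord1 expr0 mulr1.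
  exists N.+1, (fun i => if i is j.+1 then c j else r); split=> [[|i] //|].
  rewrite big_ord_recl expr0 mulr1 addrC mulr_suml; congr (_ + _).
  by apply: eq_bigr => i _; rewrite /= exprSr mulrA.
case=> N [r [Rr0 ->]]; elim: N r Rr0 => [|N IH] r Rr0.
  by rewrite big_ord0; left; apply: subring0.
rewrite big_ord_recl expr0 mulr1 addrC.
suff -> : \sum_(i < N) r (lift ord0 i) * x ^+ (lift ord0 i) =
          (\sum_(i < N) r i.+1 * x ^+ i) * x.
  by right=> //; apply: (IH (fun i => r i.+1)).
by rewrite mulr_suml; apply: eq_bigr => i _; rewrite /= exprSr mulrA.
Qed.

End OreSumSubring.

Lemma ore_sum_min R S x a : subring S -> (forall r, R r -> S r) -> S x ->
  ore_sum R x a -> S a.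
Proof.
move=> Ss RS Sx; elim=> [r /RS // | b r _ Sb /RS Sr].
by apply: subringD => //; apply: subringM.
Qed.

Fixpoint iter_ore_sum (I : Type) (z : I -> T) R (l : seq I) : set T :=
  if l is i :: l' then iter_ore_sum z (ore_sum R (z i)) l' else R.

(** What makes the sums of ordered monomials closed under products: the brackets
    of the [z i] with [R] and with each other lie in [R]. For a list of length
    one this is the commutation rule of an Ore extension. *)
Record ore_system (I : eqType) (z : I -> T) R (l : seq I) : Prop := {
  ore_system_subring : subring R;
  ore_system_coef i r : i \in l -> R r -> R (z i * r - r * z i);
  ore_system_var i j : i \in l -> j \in l -> R (z i * z j - z j * z i)
}.

(** The condition passes from [R] to [R[z_i]], because bracketing with [z_j] is a
    derivation that sends [R] and [z_i] into [R]. *)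
Lemma ore_system_step (I : eqType) (z : I -> T) R i (l : seq I) :
  ore_system z R (i :: l) -> ore_system z (ore_sum R (z i)) l.
Proof.
move=> [Rr Rz zz]; have iR r := Rz i r (mem_head _ _).
have Ss : subring (ore_sum R (z i)) by apply: ore_sum_subring.
split=> // [j r lj | j k lj lk]; last by left; apply: zz; rewrite inE ?lj ?lk orbT.
have jl : j \in i :: l by rewrite inE lj orbT.
elim=> {r} [r Rr0 | a r Sa Sja Rr0]; first by left; apply: Rz.
have -> : z j * (a * z i + r) - (a * z i + r) * z j =
   (z j * a - a * z j) * z i + (z j * r - r * z j) + a * (z j * z i - z i * z j).
  rewrite mulrDl mulrDr mulrBl mulrBr !mulrA opprD.
  by rewrite [RHS]addrAC [X in _ = X + _]addrA subrK [RHS]addrACA.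
apply: subringD => //; first by right=> //; apply: Rz.
by apply: ore_sumMr => //; apply: zz => //; apply: mem_head.
Qed.

Lemma iter_ore_sum_subring (I : eqType) (z : I -> T) R (l : seq I) :
  ore_system z R l ->
  [/\ subring (iter_ore_sum z R l), forall r, R r -> iter_ore_sum z R l r
    & forall i, i \in l -> iter_ore_sum z R l (z i)].
Proof.
elim: l R => [|i l IH] R sys /=; first by case: sys; split.
have [Is IR Iz] := IH _ (ore_system_step sys).
split=> // [r Rr0|j]; first by apply: IR; left.
rewrite inE => /orP[/eqP -> | /Iz //]; apply/IR/ore_sum_var.
by case: sys.
Qed.

End OreSums.

(** * Independence of monomials by differentiation *)

Section Independence.
Variables (K : fieldType) (A : algType K).
Hypothesis charK0 : [pchar K] =i pred0.

Lemma natr_neq0 n : n.+1%:R != 0 :> K.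
Proof. by have /pcharf0P -> := charK0. Qed.

Lemma mulrn_eq0_char0 (a : A) n : a *+ n.+1 = 0 -> a = 0.
Proof.
by rewrite -scaler_nat => /eqP; rewrite scaler_eq0 (negbTE (natr_neq0 n)) => /eqP.
Qed.

Section OneDerivation.
Variables (d : A -> A) (x : A).
Hypotheses (dd : kderivation d) (dx : d x = 1).

Lemma kder_exp n : d (x ^+ n.+1) = x ^+ n *+ n.+1.
Proof.
elim: n => [|n IH]; first by rewrite expr1 dx expr0.
by rewrite exprS (kderM dd) IH dx mul1r mulrnAr -exprS -mulrS.
Qed.

Lemma kder_coefs N (r : nat -> A) : (forall i, d (r i) = 0) ->
  d (\sum_(i < N.+1) r i * x ^+ i) = \sum_(i < N) r i.+1 *+ i.+1 * x ^+ i.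
Proof.
move=> dr; rewrite (kder_sum dd) big_ord_recl /= expr0 mulr1 dr add0r.
apply: eq_bigr => i _.
by rewrite (kderM dd) dr mul0r add0r kder_exp mulrnAr mulrnAl.
Qed.

(** Differentiation loses only the constant coefficient, since the exponents are
    invertible in characteristic zero. *)
Lemma kder_coefs_eq0 N (r : nat -> A) : (forall i, d (r i) = 0) ->
  \sum_(i < N) r i * x ^+ i = 0 -> forall i, (i < N)%N -> r i = 0.
Proof.
elim: N r => // N IH r dr s0.
have rS i : (i < N)%N -> r i.+1 = 0.
  move=> iN; apply: (@mulrn_eq0_char0 _ i); move: i iN.
  apply: (IH (fun i => r i.+1 *+ i.+1)).
    by move=> i; rewrite -scaler_nat (kderZ dd) dr scaler0.
  by rewrite -kder_coefs // s0 (kder0 dd).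
case=> [_|i]; last by rewrite ltnS => /rS.
move: s0; rewrite big_ord_recl /= expr0 mulr1 big1 ?addr0 // => i _.
by rewrite rS // mul0r.
Qed.

(** The derivative of [r_0 + r_1 x + ...] has the coefficients [n r_n], so it
    vanishes only when the sum reduces to [r_0]. *)
Lemma ore_sum_ker (R : set A) a : subring R -> (forall r, R r -> d r = 0) ->
  ore_sum R x a -> d a = 0 -> R a.
Proof.
move=> Rr dR /(ore_sum_coefs x Rr)[[|N] [r [Rr0 ->]]].
  by rewrite big_ord0 => _; apply: subring0.
rewrite kder_coefs; last by move=> i; apply: dR.
have dr' i : d (r i.+1 *+ i.+1) = 0.
  by rewrite -scaler_nat (kderZ dd) dR ?scaler0.
move=> /(kder_coefs_eq0 (r := fun i => r i.+1 *+ i.+1) dr') r0.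
rewrite big_ord_recl expr0 mulr1 big1 ?addr0 // => i _ /=.
by rewrite (@mulrn_eq0_char0 (r i.+1) i) ?mul0r //; apply: r0.
Qed.

(** The image of [r_0 + r_1 z + ...] is a sum in powers of [x] with constant
    coefficients, all of which can be recovered by differentiation. *)
Lemma ore_sum_inj (T : pzRingType) (f : {rmorphism T -> A}) (R : set T) z a :
  subring R -> f z = x -> (forall r, R r -> d (f r) = 0) ->
  (forall r, R r -> f r = 0 -> r = 0) -> ore_sum R z a -> f a = 0 -> a = 0.
Proof.
move=> Rr fz dfR fR /(ore_sum_coefs z Rr)[N [r [Rr0 ->]]] fa0.
have dfr i : d (f (r i)) = 0 by apply: dfR.
rewrite big1 // => i _; rewrite (fR (r i)) ?mul0r //.
apply: (@kder_coefs_eq0 N (fun i => f (r i))) => //.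
by apply: etrans fa0; rewrite rmorph_sum; apply: eq_bigr => j _;
  rewrite rmorphM rmorphXn fz.
Qed.

End OneDerivation.

Section Families.
Variables (I : eqType) (d : I -> A -> A) (x : I -> A).
Hypothesis dd : forall i, kderivation (d i).

Lemma ore_sum_const (T : pzRingType) (f : {rmorphism T -> A}) (R : set T)
    (z : T) i :
  (forall r, R r -> d i (f r) = 0) -> d i (f z) = 0 ->
  forall a, ore_sum R z a -> d i (f a) = 0.
Proof.
move=> dR dz a; elim=> {a} [r /dR // | a r _ da /dR dr].
by rewrite rmorphD rmorphM (kderD (dd i)) (kderM (dd i)) da dr dz mul0r mulr0 !addr0.
Qed.

(** The variables are adjoined one at a time, and each is eliminated by its own
    derivation, for which the earlier variables are constants. This is what
    identifies a presented algebra with a concrete one: the former is spanned by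
    ordered monomials, and the derivations of the latter separate them. *)
Lemma iter_ore_sum_inj (T : pzRingType) (f : {rmorphism T -> A}) (R : set T)
    (z : I -> T) (l : seq I) :
  uniq l -> ore_system z R l ->
  (forall i r, i \in l -> R r -> d i (f r) = 0) ->
  (forall i j, i \in l -> j \in l -> d i (f (z j)) = (i == j)%:R) ->
  (forall r, R r -> f r = 0 -> r = 0) ->
  forall a, iter_ore_sum z R l a -> f a = 0 -> a = 0.
Proof.
elim: l R => [|i l IH] R //= /andP[il ul] sys dR dz fR a.
have subl j : j \in l -> j \in i :: l by rewrite inE => ->; rewrite orbT.
apply: IH => //; first exact: ore_system_step.
- move=> j r lj; apply: ore_sum_const => [{}r|]; first exact/dR/subl.
  rewrite dz ?mem_head ?subl //; have [ji|//] := eqVneq j i.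
  by rewrite -ji lj in il.
- by move=> j k lj lk; apply: dz; apply: subl.
move=> r; apply: (@ore_sum_inj (d i) (f (z i)) _ _ T f R (z i)) => //.
- by rewrite dz ?mem_head // eqxx.
- by case: sys.
- by move=> r' Rr'; apply: dR => //; apply: mem_head.
Qed.

(** Peeling off the variables from the last to the first, each derivation removes
    its own. *)
Lemma iter_ore_sum_ker (R : set A) (l : seq I) :
  uniq l -> ore_system x R l ->
  (forall i r, i \in l -> R r -> d i r = 0) ->
  (forall i j, i \in l -> j \in l -> d i (x j) = (i == j)%:R) ->
  forall a, iter_ore_sum x R l a -> (forall i, i \in l -> d i a = 0) -> R a.
Proof.
elim: l R => [|i l IH] R //= /andP[il ul] sys dR dx a Sa da.
have subl j : j \in l -> j \in i :: l by rewrite inE => ->; rewrite orbT.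
have Sia : ore_sum R (x i) a.
  apply: (IH _ _ (ore_system_step sys)) => // [j r lj|j k lj lk|j lj].
  - apply: (@ore_sum_const A idfun) => [{}r|]; first exact/dR/subl.
    rewrite dx ?mem_head ?subl //; have [ji|//] := eqVneq j i.
    by rewrite -ji lj in il.
  - by apply: dx; apply: subl.
  - exact/da/subl.
apply: (@ore_sum_ker (d i) (x i)) Sia _ => //.
- by rewrite dx ?mem_head // eqxx.
- by case: sys.
- by move=> r; apply: dR; apply: mem_head.
- by apply: da; apply: mem_head.
Qed.

End Families.
End Independence.

(** * Algebras given by generators and relations *)

Section Packing.
Variables (K : fieldType) (A : algType K) (T : pzRingType) (f : T -> A).
Hypotheses (fB : zmod_morphism f) (f1 : monoid_morphism f).

(** Gives access to the generic theory of ring morphisms for the unbundled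
    morphisms that occur in the notions of isomorphism used here. *)
Definition rmorph_pack : {rmorphism T -> A} :=
  HB.pack f (GRing.isZmodMorphism.Build T A f fB)
    (GRing.isMonoidMorphism.Build T A f f1).
End Packing.

Section PresentedAlgebras.
Variables (K : fieldType) (X : Type) (rel : expr K X -> expr K X -> Prop).
Implicit Types t u : expr K X.

Lemma pres_classD t u :
  pres_class rel (EAdd t u) = pres_class rel t + pres_class rel u.
Proof. by rewrite [RHS]pres_addfE. Qed.

Lemma pres_classM t u :
  pres_class rel (EMul t u) = pres_class rel t * pres_class rel u.
Proof. by rewrite [RHS]pres_mulfE. Qed.

Lemma pres_classZ k t :
  pres_class rel (EMul (ECst k) t) = k *: pres_class rel t.
Proof. by rewrite [RHS]pres_scalefE. Qed.

Lemma pres_class_cst k : pres_class rel (ECst k) = k *: (1 : presented rel).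
Proof. by rewrite -[LHS]mulr1 -pres_classM pres_classZ. Qed.

Lemma presented_ind (P : presented rel -> Prop) :
  (forall k, P (k *: (1 : presented rel))) -> (forall i, P (pres_gen rel i)) ->
  (forall a b, P a -> P b -> P (a + b)) ->
  (forall a b, P a -> P b -> P (a * b)) -> forall a, P a.
Proof.
move=> Pk Pg PD PM a; rewrite -(pres_reprK a).
elim: (pres_repr a) => [k|i|t Pt u Pu|t Pt u Pu]; first by rewrite pres_class_cst.
- exact: Pg.
- by rewrite pres_classD; apply: PD.
- by rewrite pres_classM; apply: PM.
Qed.

Section Lift.
Variables (A : algType K) (g : X -> A).

Fixpoint expr_eval t : A :=
  match t with
  | ECst k => k%:A
  | EGen i => g i
  | EAdd t u => expr_eval t + expr_eval u
  | EMul t u => expr_eval t * expr_eval u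
  end.

Hypothesis g_rel : forall t u, rel t u -> expr_eval t = expr_eval u.

Lemma expr_eval_eq t u : pres_eq rel t u -> expr_eval t = expr_eval u.
Proof.
elim=> {t u} //=.
- by move=> t u v _ -> _ ->.
- by move=> t t' u u' _ -> _ ->.
- by move=> t t' u u' _ -> _ ->.
- by move=> *; rewrite addrA.
- by move=> *; rewrite addrC.
- by move=> *; rewrite scale0r add0r.
- by move=> *; rewrite mulrA.
- by move=> *; rewrite scale1r mul1r.
- by move=> *; rewrite mulrDl.
- by move=> *; rewrite mulrDr.
- by move=> *; rewrite scale0r mul0r.
- by move=> *; rewrite scalerDl.
- by move=> *; rewrite -scalerAl mul1r scalerA.
- by move=> *; rewrite -scalerAl -scalerAr mul1r mulr1.
Qed.

Definition pres_lift (a : presented rel) : A := expr_eval (pres_repr a).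

Lemma pres_liftE t : pres_lift (pres_class rel t) = expr_eval t.
Proof. exact/expr_eval_eq/pres_repr_class. Qed.

Lemma pres_lift_gen i : pres_lift (pres_gen rel i) = g i.
Proof. exact: pres_liftE. Qed.

Lemma pres_lift_linear : linear pres_lift.
Proof.
move=> k; elim/presW=> t; elim/presW=> u.
by rewrite -pres_classZ -pres_classD !pres_liftE /= -scalerAl mul1r.
Qed.

Lemma pres_lift_monoid : monoid_morphism pres_lift.
Proof.
split; first by rewrite [LHS]pres_liftE /= scale1r.
by elim/presW=> t; elim/presW=> u; rewrite -pres_classM !pres_liftE.
Qed.

End Lift.
End PresentedAlgebras.

Lemma linear_zmod (K : fieldType) (U V : lmodType K) (f : U -> V) :
  linear f -> zmod_morphism f.
Proof. by move=> fl a b; rewrite addrC -scaleN1r fl scaleN1r addrC. Qed.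

Lemma linear_add (K : fieldType) (U W : lmodType K) (g : U -> W) :
  linear g -> {morph g : u v / u + v}.
Proof. by move=> gl u v; have := gl 1 u v; rewrite !scale1r. Qed.

Lemma linear_scale (K : fieldType) (U W : lmodType K) (g : U -> W) :
  linear g -> forall k, {morph g : u / k *: u}.
Proof.
move=> gl k u; have g0 : g 0 = 0.
  by apply: (addrI (g 0)); rewrite -(linear_add gl) !addr0.
by rewrite -[k *: u]addr0 gl g0 addr0.
Qed.

Section Subalgebras.
Variables (K : fieldType) (A : algType K).

Lemma subalgebra_subring (R : set A) : subalgebra R -> subring R.
Proof.
move=> [R1 RD RM RZ]; split=> // a b Ra Rb.
by rewrite -scaleN1r; apply: RD => //; apply: RZ.
Qed.

Lemma subalgebraZ (R : set A) k a : subalgebra R -> R a -> R (k *: a).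
Proof. by move=> [_ _ _]; apply. Qed.

Lemma scalars_subalgebra : subalgebra (@scalars K A).
Proof.
split=> [|_ _ [k _ <-] [k' _ <-]|_ _ [k _ <-] [k' _ <-]|k _ [k' _ <-]].
- by exists 1; rewrite ?scale1r.
- by exists (k + k'); rewrite ?scalerDl.
- by exists (k * k'); rewrite // -scalerAl mul1r scalerA.
- by exists (k * k'); rewrite ?scalerA.
Qed.

Lemma subalgebra_scalar (R : set A) k : subalgebra R -> R k%:A.
Proof. by move=> Ra; apply: subalgebraZ => //; case: Ra. Qed.

End Subalgebras.

(** * Ore extensions *)

Section OreExtensions.
Variables (K : fieldType) (A : algType K).
Hypothesis charK0 : [pchar K] =i pred0.
Implicit Types (R S : set A) (x : A) (d e : A -> A).

Section Coefs.
Variables (R : set A) (d : A -> A).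
Hypothesis Ra : subalgebra R.
Let Rr := subalgebra_subring Ra.
Implicit Types r : {r : A | R r}.

Lemma ore_coef_scalar k r : sval r = k%:A -> ore_coef d r = k *: (1 : ore_ext R d).
Proof.
by move=> rk; rewrite -pres_class_cst; apply/pres_classP/pres_rel/ore_scalar.
Qed.

Lemma ore_coefD r1 r2 r : sval r = sval r1 + sval r2 ->
  ore_coef d r = ore_coef d r1 + ore_coef d r2.
Proof. by move=> rE; rewrite -pres_classD; apply/pres_classP/pres_rel/ore_add. Qed.

Lemma ore_coefM r1 r2 r : sval r = sval r1 * sval r2 ->
  ore_coef d r = ore_coef d r1 * ore_coef d r2.
Proof. by move=> rE; rewrite -pres_classM; apply/pres_classP/pres_rel/ore_mul. Qed.

Lemma ore_varM r r' : sval r' = d (sval r) ->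
  ore_var R d * ore_coef d r = ore_coef d r * ore_var R d + ore_coef d r'.
Proof.
by move=> rE; rewrite -!pres_classM -pres_classD; apply/pres_classP/pres_rel/ore_comm.
Qed.

Lemma ore_coef_subring : subring (range (@ore_coef K A R d)).
Proof.
have R0 : R 0 := subring0 Rr.
split=> [|_ _ [r _ <-] [r' _ <-]|_ _ [r _ <-] [r' _ <-]].
- exists (exist _ 1 (subring1 Rr)) => //.
  by rewrite (@ore_coef_scalar 1) ?scale1r.
- exists (exist _ _ (subringB Rr (svalP r) (svalP r'))) => //.
  apply: (addIr (ore_coef d r')); rewrite subrK -(@ore_coefD _ _ r) //=.
  by rewrite subrK.
- exists (exist _ _ (subringM Rr (svalP r) (svalP r'))) => //.
  exact: ore_coefM.
Qed.

(** The relation [X r = r X + d(r)] brings all coefficients to the left. *)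
Lemma ore_ext_sum (Rd : forall b, R b -> R (d b)) (a : ore_ext R d) :
  ore_sum (range (@ore_coef K A R d)) (ore_var R d) a.
Proof.
have Cr := ore_coef_subring.
have CX c : range (@ore_coef K A R d) c ->
    range (@ore_coef K A R d) (ore_var R d * c - c * ore_var R d).
  move=> [r _ <-]; exists (exist _ _ (Rd _ (svalP r))) => //.
  by rewrite (@ore_varM r (exist _ _ (Rd _ (svalP r)))) // addrC addKr.
have Ss := ore_sum_subring Cr CX.
elim/presented_ind: a => [k|[r|]|a b|a b].
- left; exists (exist _ _ (subalgebra_scalar k Ra)) => //.
  exact: ore_coef_scalar.
- by left; exists r.
- exact: (ore_sum_var (ore_var R d) Cr).
- exact: subringD.
- exact: subringM.
Qed.

End Coefs.

(** The sums [r_0 + r_1 x + ...] are a free left [R]-module on the powers of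
    [x] because [e] differentiates them as polynomials in [x]; hence the
    canonical map from the presented extension is injective. *)
Lemma is_ore_ext_sum R x d e :
  subalgebra R -> kderivation e -> e x = 1 -> (forall r, R r -> e r = 0) ->
  (forall r, R r -> x * r - r * x = d r) -> (forall r, R r -> R (d r)) ->
  is_ore_ext R x d (ore_sum R x).
Proof.
move=> Ra de ex eR Rx Rd; have Rr := subalgebra_subring Ra.
have [R1 RD RM RZ] := Ra.
have Rbr r : R r -> R (x * r - r * x) by move=> Rr0; rewrite Rx //; apply: Rd.
split=> //.
  split=> // [k a b Ra0 Rb|a b Ra0 Rb].
    have := kder_lin (bracket_kder x) k a b; rewrite /bracket !Rx //.
    by apply: RD => //; apply: RZ.
  by have := kderM (bracket_kder x) a b; rewrite /bracket !Rx //; apply: RM.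
pose g (o : option {r : A | R r}) := if o is Some r then sval r else x.
have g_rel t u : @ore_rel K A R d t u -> expr_eval g t = expr_eval g u.
  case=> //= r r' ->; rewrite -Rx; last exact: svalP.
  by rewrite addrC subrK.
pose f := rmorph_pack (linear_zmod (pres_lift_linear g_rel)) (pres_lift_monoid g_rel).
have fc r : f (ore_coef d r) = sval r by apply: pres_lift_gen.
have fX : f (ore_var R d) = x by apply: pres_lift_gen.
exists f; split=> //.
- split; [exact: pres_lift_linear | exact: pres_lift_monoid].
- apply: raddf_inj => a fa0.
  apply: (@ore_sum_inj _ _ charK0 e x de ex _ f (range (@ore_coef K A R d))
    (ore_var R d) a (ore_coef_subring _ Ra)) => //.
  + by move=> _ [r _ <-]; rewrite fc; apply/eR/svalP.
  + move=> _ [r _ <-]; rewrite fc => r0.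
    by rewrite (@ore_coef_scalar _ _ 0) ?scale0r.
  + exact: ore_ext_sum.
apply/seteqP; split=> a.
  move=> [b _ <-]; elim: (ore_ext_sum Ra Rd b) => [_ [r _ <-]|c _ _ Sc [r _ <-]].
    by rewrite fc; left; apply: svalP.
  by rewrite rmorphD rmorphM fX fc; right=> //; apply: svalP.
elim=> {a} [r Rr0|a r _ [b _ <-] Rr0].
  by exists (ore_coef d (exist _ r Rr0)).
exists (b * ore_var R d + ore_coef d (exist _ r Rr0)) => //.
by rewrite rmorphD rmorphM fX fc.
Qed.

(** The isomorphism carries the sums of powers of the formal variable to sums of
    powers of [x], and its commutation rule to that of [x]. *)
Lemma is_ore_extE R x d S : is_ore_ext R x d S ->
  S = ore_sum R x /\ forall r, R r -> x * r - r * x = d r.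
Proof.
move=> [Ra [Rd _ _] [f [[fl fm] fc fX _ fS]]].
pose F := rmorph_pack (linear_zmod fl) fm.
have Fc r : F (ore_coef d r) = sval r by apply: fc.
have FX : F (ore_var R d) = x by apply: fX.
split; last first.
  move=> r Rr; have Rdr := Rd _ Rr.
  have /(congr1 F) := @ore_varM R d (exist _ r Rr) (exist _ _ Rdr) erefl.
  by rewrite rmorphD !rmorphM FX !Fc /= => ->; rewrite addrC addKr.
rewrite -fS; apply/seteqP; split=> a.
  move=> [b _ <-]; rewrite -[f b]/(F b).
  elim: (ore_ext_sum Ra Rd b) => [_ [r _ <-]|c _ _ Sc [r _ <-]].
    by rewrite Fc; left; apply: svalP.
  by rewrite rmorphD rmorphM FX Fc; right=> //; apply: svalP.
elim=> {a} [r Rr0|a r _ [b _ <-] Rr0].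
  by exists (ore_coef d (exist _ r Rr0)).
exists (b * ore_var R d + ore_coef d (exist _ r Rr0)) => //.
by rewrite -[LHS]/(F _) rmorphD rmorphM FX Fc.
Qed.

(** [take (index k l) l] lists the variables adjoined before [k]; only on the
    algebra that they generate is [d k] prescribed. *)
Lemma is_iter_oreE (I : eqType) (x : I -> A) (d : I -> A -> A) R l S :
  is_iter_ore x d R l S ->
  S = iter_ore_sum x R l /\
  forall k r, k \in l -> iter_ore_sum x R (take (index k l) l) r ->
    x k * r - r * x k = d k r.
Proof.
elim: l R => [|i l IH] R /=; first by move=> ->.
move=> [R' [/is_ore_extE[-> Rx] /IH[-> Rl]]]; split=> // k r.
rewrite inE eq_sym; case: eqVneq => [<- _|_ kl] /=; first exact: Rx.
exact: Rl.
Qed.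

Lemma iter_ore_sum_coef (I : eqType) (x : I -> A) R l r :
  R r -> iter_ore_sum x R l r.
Proof. by elim: l R => //= i l IH R Rr; apply: IH; left. Qed.

Lemma iter_ore_sum_var (I : eqType) (x : I -> A) R l i :
  subring R -> i \in l -> iter_ore_sum x R l (x i).
Proof.
move=> Rr; have : R 0 /\ R 1 by split; [apply: subring0 | apply: subring1].
elim: l R {Rr} => //= j l IH R [R0 R1]; rewrite inE => /orP[/eqP ->|il].
  apply: iter_ore_sum_coef; rewrite -[X in ore_sum _ _ X]addr0 -[X in X + 0]mul1r.
  by right=> //; left.
by apply: IH => //; split; left.
Qed.

End OreExtensions.

(** * Coordinates for commuting locally nilpotent derivations *)

Section Generated.
Variables (K : fieldType) (A : algType K).

Definition generated (I : Type) (x : I -> A) : set A :=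
  [set a | forall B, subalgebra B -> (forall i, B (x i)) -> B a].

Lemma generated_subalgebra I (x : I -> A) : subalgebra (generated x).
Proof.
split=> [B [] //|a b Ga Gb B Ba Bx|a b Ga Gb B Ba Bx|k a Ga B Ba Bx];
  have [_ BD BM BZ] := Ba.
- by apply: BD; [apply: Ga | apply: Gb].
- by apply: BM; [apply: Ga | apply: Gb].
- by apply: BZ; apply: Ga.
Qed.

Lemma generated_gen I (x : I -> A) i : generated x (x i).
Proof. by move=> B _; apply. Qed.

Lemma subring_subalgebra (R : set A) :
  subring R -> (forall k, R k%:A) -> subalgebra R.
Proof.
move=> Rr Rk; split; [exact: subring1 | exact: subringD | exact: subringM |].
by move=> k a Ra; rewrite -[a]mul1r scalerAl; apply: subringM.
Qed.

Lemma scalars_sub (B : set A) r : subalgebra B -> scalars r -> B r.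
Proof. by move=> Ba [k _ <-]; apply: subalgebra_scalar. Qed.

Lemma scalar_in k : scalars (k%:A : A).
Proof. by exists k. Qed.

Lemma iter_ore_sum_min (I : eqType) (x : I -> A) R l B a :
  subalgebra B -> (forall r, R r -> B r) -> (forall i, i \in l -> B (x i)) ->
  iter_ore_sum x R l a -> B a.
Proof.
move=> Ba; elim: l R => [|i l IH] R RB Bx /=; first exact: RB.
apply: IH => [r|j lj]; last by apply: Bx; rewrite inE lj orbT.
apply: ore_sum_min => //; first exact: subalgebra_subring.
by apply: Bx; apply: mem_head.
Qed.

Lemma nilpotent_subalgebra (d : A -> A) :
  kderivation d -> subalgebra [set a | exists k, iter k d a = 0].
Proof.
move=> dd; split=> [|a b [m am] [n bn]|a b [m am] [n bn]|k a [m am]].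
- by exists 1%N; apply: kder1.
- exists (m + n)%N; rewrite kder_iterD // {1}addnC !iterD am bn.
  by rewrite !kder_iter0 // addr0.
- by exists (m + n)%N; apply: kder_iterM_eq0.
- by exists m; rewrite kder_iterZ // am scaler0.
Qed.

Lemma kder_comm_subalgebra (d e : A -> A) : kderivation d -> kderivation e ->
  subalgebra [set a | d (e a) = e (d a)].
Proof.
move=> dd de; split=> [|a b /= ea eb|a b /= ea eb|k a /= ea].
- by rewrite /= !kder1 // !kder0.
- by rewrite (kderD de) !(kderD dd) (kderD de) ea eb.
- rewrite (kderM de) (kderD dd) !(kderM dd) (kderD de) !(kderM de) ea eb.
  by rewrite !addrA; congr (_ + _); rewrite addrAC.
- by rewrite (kderZ de) !(kderZ dd) (kderZ de) ea.
Qed.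

End Generated.

Section Families.
Variables (K : fieldType) (A : algType K).
Hypothesis charK0 : [pchar K] =i pred0.
Variables (s : nat).
Implicit Types (delta : 'I_s -> A -> A) (x : 'I_s -> A).

Lemma kronecker_kder0 delta x i j :
  kronecker delta x -> i != j -> delta i (x j) = 0.
Proof. by move=> kr /negPf ij; rewrite kr ij. Qed.

Lemma kronecker_kder1 delta x i : kronecker delta x -> delta i (x i) = 1.
Proof. by move=> kr; rewrite kr eqxx. Qed.

(** Since [C_i] is not redundant in the intersection of all kernels, some [a]
    lies in every [C_j] with [j != i] but not in [C_i]. The last nonzero element
    of the sequence [delta_i^k a] lies in all kernels, hence in [K]; its
    predecessor, divided by this scalar, is the coordinate [x_i]. *)
Lemma lnd_coordinates delta : lnd_family delta -> exists x, kronecker delta x.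
Proof.
move=> [dd dnil _ dcomm dgen dcap].
suff coord i : exists a, forall j, delta j a = (j == i)%:R.
  by have [x xP] := choice coord; exists x => j i; apply: xP.
have [a [aj ai]] : exists a, (forall j, j != i -> delta j a = 0) /\ delta i a <> 0.
  apply: contrapT => none; have /setP/(_ i) : [set~ i]%SET = [set: 'I_s]%SET.
    apply: dgen; apply/seteqP; split=> a aC j _ /=; last first.
      by apply: aC; rewrite /= inE.
    have aj k : k != i -> delta k a = 0 by move=> ki; apply: aC; rewrite /= !inE.
    have [->|/aj //] := eqVneq j i.
    by apply: contrapT => ai; apply: none; exists a.
  by rewrite !inE eqxx.
have ex : exists k, iter k (delta i) a == 0.
  by have [k ak] := dnil i a; exists k; apply/eqP.
(* The least exponent killing [a] is at least 2, as [delta i a] is nonzero. *)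
case: (ex_minnP ex) => -[|[|k]] /eqP ak kmin.
- by case: ai; rewrite [a]ak (kder0 (dd i)).
- by case: ai.
set b := iter k (delta i) a.
have bj j : j != i -> delta j b = 0.
  move=> ji; rewrite /b; elim: (k) => [|n IH] /=; first exact: aj.
  by rewrite dcomm IH (kder0 (dd i)).
have [c _ cE] : scalars (delta i b).
  rewrite -dcap => j _; rewrite /derker /=; have [->//|ji] := eqVneq j i.
  by rewrite dcomm bj // (kder0 (dd i)).
have c0 : c != 0.
  apply/eqP => c0; have := kmin k.+1; rewrite /= -/b -cE c0 scale0r eqxx.
  by move=> /(_ isT); rewrite ltnn.
exists (c^-1 *: b) => j; rewrite (kderZ (dd j)).
have [->|ji] := eqVneq j i; last by rewrite bj // scaler0.
by rewrite -cE scalerA mulVf // scale1r.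
Qed.

(** By Taylor expansion this turns out to be the subalgebra generated by the
    coordinates [x j] with [P j]. *)
Definition constants delta (P : pred 'I_s) : set A :=
  [set a | forall j, ~~ P j -> delta j a = 0].

Lemma eq_constants delta (P Q : pred 'I_s) :
  P =1 Q -> constants delta P = constants delta Q.
Proof.
move=> PQ; apply/seteqP; split=> a aP j; first by rewrite -PQ; apply: aP.
by rewrite PQ; apply: aP.
Qed.

Section Coordinates.
Variables (delta : 'I_s -> A -> A) (x : 'I_s -> A).
Hypotheses (lnd : lnd_family delta) (kr : kronecker delta x).
Let dd := lnd_der lnd.
Local Notation constants := (constants delta).
Local Notation scalars := (@scalars K A).

Lemma constants_subalgebra P : subalgebra (constants P).
Proof.
split=> [|a b aP bP|a b aP bP|k a aP] j jP.
- exact: kder1.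
- by rewrite (kderD (dd j)) aP // bP // addr0.
- by rewrite (kderM (dd j)) aP // bP // mul0r mulr0 addr0.
- by rewrite (kderZ (dd j)) aP // scaler0.
Qed.

Lemma constants_var (P : pred 'I_s) i : P i -> constants P (x i).
Proof. by move=> Pi j jP; apply: (kronecker_kder0 kr); apply: contraNneq jP => ->. Qed.

Lemma constants0 : constants pred0 = scalars.
Proof.
rewrite -(lnd_cap lnd); apply/seteqP; split=> a aP j _ /=; first exact: aP.
exact: aP.
Qed.

Lemma constantsT : constants predT = setT.
Proof. by apply/seteqP; split. Qed.

(** [delta_j x_k] is a scalar, so [delta_j] does not see the first factor. *)
Lemma kder_bracket_var k j r : delta j (bracket (x k) r) = bracket (x k) (delta j r).
Proof.
rewrite kder_bracket // kr bracketC -scaler_nat bracket_scalar oppr0 add0r.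
by [].
Qed.

Lemma constants_bracket P k r : constants P r -> constants P (bracket (x k) r).
Proof.
move=> rP j jP; rewrite kder_bracket_var rP //.
exact/kder0/bracket_kder.
Qed.

(** The bracket is killed by all the derivations. *)
Lemma bracket_var_scalar i j : scalars (bracket (x i) (x j)).
Proof.
rewrite -constants0 => k _; rewrite kder_bracket_var kr -scaler_nat.
exact: bracket_scalar.
Qed.

Lemma constants_sub P i r : constants P r -> constants (predU1 i P) r.
Proof. by move=> rP j; rewrite /= negb_or => /andP[_ /rP]. Qed.

(** Taylor expansion up to order [N]: a primitive of [delta_i a] that is
    polynomial in [x_i] differs from [a] by an element without [x_i]. *)
Lemma constants_expand P i N a :
  ~~ P i -> constants (predU1 i P) a -> iter N (delta i) a = 0 ->
  exists2 r : nat -> A, forall e, constants P (r e)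
    & a = \sum_(e < N) r e * x i ^+ e.
Proof.
move=> iP; have Ca := constants_subalgebra P; have Cr := subalgebra_subring Ca.
elim: N a => [|N IH] a aP aN.
  by exists (fun=> 0) => [e|]; [apply: subring0 | rewrite big_ord0].
have [||r rP daE] := IH (delta i a); last 1 first.
- pose c e := if e is j.+1 then (j.+1%:R)^-1 *: r j else 0.
  have cP e : constants P (c e).
    by case: e => [|e]; [apply: subring0 | apply: (subalgebraZ _ Ca)].
  set b := \sum_(e < N.+1) c e * x i ^+ e.
  have bE : b = \sum_(e < N) c e.+1 * x i ^+ e.+1.
    by rewrite /b big_ord_recl /= mul0r add0r.
  have db : delta i b = delta i a.
    rewrite (kder_coefs (dd i) (kronecker_kder1 i kr)) => [|e]; last exact: cP.
    rewrite daE; apply: eq_bigr => e _ /=.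
    by rewrite -scaler_nat scalerA divff ?natr_neq0 ?scale1r.
  exists (fun e => if e is _.+1 then c e else a - b); last first.
    by rewrite big_ord_recl /= expr0 mulr1 -bE subrK.
  case=> [|e]; last exact: (cP e.+1).
  move=> j jP; rewrite (kderB (dd j)).
  have [->|ji] := eqVneq j i; first by rewrite db subrr.
  rewrite aP ?sub0r; last by rewrite /= negb_or ji.
  rewrite /b (kder_sum (dd j)) big1 ?oppr0 // => e _.
  have Cx : constants (predU1 i P) (x i ^+ e).
    have Cir := subalgebra_subring (constants_subalgebra (predU1 i P)).
    elim: (e : nat) => [|n IHn]; first exact: subring1.
    rewrite exprS; apply: subringM IHn => //.
    by apply: constants_var; rewrite /= eqxx.
  by rewrite (kderM (dd j)) (cP e) // Cx ?mul0r ?mulr0 ?addr0 //= negb_or ji.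
- by move=> j jP; rewrite (lnd_comm lnd) aP // (kder0 (dd i)).
- by rewrite -iterSr.
Qed.

(** Local nilpotency makes every Taylor expansion finite. *)
Lemma constants_step P i : ~~ P i ->
  constants (predU1 i P) = ore_sum (constants P) (x i).
Proof.
move=> iP; have Cr := subalgebra_subring (constants_subalgebra P).
apply/seteqP; split=> a.
  have [N aN] := lnd_nilp lnd i a => aP.
  have [r rP ->] := constants_expand iP aP aN.
  by apply/ore_sum_coefs => //; exists N, r.
apply: ore_sum_min => [|r|].
- exact/subalgebra_subring/constants_subalgebra.
- exact: constants_sub.
- by apply: constants_var; rewrite /= eqxx.
Qed.

Lemma iter_ore_sum_constants P l : uniq l -> (forall i, i \in l -> ~~ P i) ->
  iter_ore_sum x (constants P) l = constants (predU P (mem l)).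
Proof.
elim: l P => [|i l IH] P /=.
  by move=> _ _; apply: eq_constants => j /=; rewrite orbF.
move=> /andP[il ul] lP; rewrite -constants_step ?lP ?mem_head //.
rewrite IH // => [|j lj /=]; last first.
  by rewrite negb_or lP ?inE ?lj ?orbT // andbT; apply: contraNneq il => <-.
by apply: eq_constants => j /=; rewrite inE; case: (j == i); rewrite ?orbT.
Qed.

Lemma iter_ore_sum_scalars l : uniq l ->
  iter_ore_sum x scalars l = constants (mem l).
Proof. by move=> ul; rewrite -constants0 iter_ore_sum_constants. Qed.

Lemma constants_generated l : uniq l ->
  constants (mem l) = generated (fun i : 'I_(size l) => x (tnth (in_tuple l) i)).
Proof.
move=> ul; apply/seteqP; split=> a; last first.
  apply=> [|i]; first exact: constants_subalgebra.
  by apply: constants_var; apply: mem_tnth.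
rewrite -iter_ore_sum_scalars //.
apply: iter_ore_sum_min (generated_subalgebra _) _ _.
  by move=> r; apply: scalars_sub; apply: generated_subalgebra.
move=> i il; have /tnthP[k ->] : i \in in_tuple l by [].
exact: (@generated_gen _ _ _ (fun i => x (tnth (in_tuple l) i)) k).
Qed.

(** The lists have to be increasing because [d k] is only known to be the bracket
    with [x k] on the algebra of the [x j] with [j < k]. *)
Lemma constants_iter_ore (d : 'I_s -> A -> A) (l1 l2 : seq 'I_s) :
  pairwise (fun i j : 'I_s => (i < j)%N) (l1 ++ l2) ->
  (forall (k : 'I_s) r, constants [pred j : 'I_s | (j < k)%N] r ->
     x k * r - r * x k = d k r) ->
  is_iter_ore x d (constants (mem l1)) l2 (constants (mem (l1 ++ l2))).
Proof.
move=> + dE; elim: l2 l1 => [|i l2 IH] l1 /=; first by rewrite cats0.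
rewrite -cat_rcons => pw; exists (constants (mem (rcons l1 i))); split; last exact: IH.
have l1i j : j \in l1 -> (j < i)%N.
  move: pw; rewrite pairwise_cat pairwise_rcons -andbA => /and4P[_ + _ _] jl.
  by move=> /allP/(_ _ jl).
have il1 : i \notin l1 by apply/negP => /l1i; rewrite ltnn.
have -> : constants (mem (rcons l1 i)) = ore_sum (constants (mem l1)) (x i).
  by rewrite -constants_step //; apply: eq_constants => j; rewrite /= mem_rcons inE.
have dl1 r : constants (mem l1) r -> x i * r - r * x i = d i r.
  move=> rl; apply: dE => j /=; rewrite -leqNgt => ij; apply: rl.
  by apply/negP => /= /l1i; rewrite ltnNge ij.
apply: (is_ore_ext_sum charK0 (constants_subalgebra _) (dd i)) => //.
- exact: (kronecker_kder1 i kr).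
- by move=> r; apply.
- by move=> r rl; rewrite -dl1 //; apply: (constants_bracket i rl).
Qed.

Lemma enum_ord_pairwise : pairwise (fun i j : 'I_s => (i < j)%N) (enum 'I_s).
Proof.
rewrite -(@pairwise_map _ _ (@nat_of_ord s) ltn) val_enum_ord.
by rewrite -sorted_pairwise ?iota_ltn_sorted //; apply: ltn_trans.
Qed.

Lemma constants_scalar_iter_ore d (lambda : 'I_s -> 'I_s -> K) (l : seq 'I_s) :
  pairwise (fun i j : 'I_s => (i < j)%N) l ->
  (forall (k : 'I_s) r, constants [pred j : 'I_s | (j < k)%N] r ->
     x k * r - r * x k = d k r) ->
  (forall i j : 'I_s, (j < i)%N -> bracket (x i) (x j) = (lambda i j)%:A) ->
  scalar_iter_ore x d lambda l (constants (mem l)).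
Proof.
move=> pl dE lE; split.
  by rewrite -constants0; apply: (@constants_iter_ore d [::] l).
by move=> i j _ _ ji; rewrite -lE // -dE //; apply: constants_var.
Qed.

Lemma lnd_ore_family : exists d lambda, ore_family x d lambda delta.
Proof.
have /choice[lam lamE] : forall i, exists lam : 'I_s -> K,
    forall j, bracket (x i) (x j) = (lam j)%:A.
  move=> i; suff /choice[lam lamE] : forall j, exists c : K, bracket (x i) (x j) = c%:A.
    by exists lam.
  by move=> j; have [c _ <-] := bracket_var_scalar i j; exists c.
exists (fun i => bracket (x i)), lam; split=> //.
have -> : setT = constants (mem (enum 'I_s)).
  by rewrite -constantsT; apply: eq_constants => j; rewrite /= mem_enum.
exact: constants_scalar_iter_ore enum_ord_pairwise _ _.
Qed.

(** Two elements with the same values under all [delta_i] differ by an element of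
    the intersection of the kernels, which is [K]. *)
Lemma kronecker_unique (y : 'I_s -> A) : kronecker delta y <->
  exists c : 'I_s -> K, forall j, y j = x j + (c j)%:A.
Proof.
split=> [ky | [c yE] i j]; last by rewrite yE (kderD (dd i)) kr kder_scalar ?addr0.
have /choice[c cE] : forall j, exists c : K, y j - x j = c%:A.
  move=> j; suff [c _ <-] : scalars (y j - x j) by exists c.
  by rewrite -constants0 => k _; rewrite (kderB (dd k)) kr ky subrr.
by exists c => j; rewrite -cE addrC subrK.
Qed.

End Coordinates.

Section FromOre.
Variables (x : 'I_s -> A) (d : 'I_s -> A -> A) (lambda : 'I_s -> 'I_s -> K).
Hypothesis io : scalar_iter_ore x d lambda (enum 'I_s) setT.

Lemma mem_take_enum (i j : 'I_s) :
  (j \in take (index i (enum 'I_s)) (enum 'I_s)) = (j < i)%N.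
Proof. by rewrite in_take ?mem_enum // !index_enum_ord. Qed.

Lemma iter_ore_bracket (i j : 'I_s) : (j < i)%N -> bracket (x i) (x j) = (lambda i j)%:A.
Proof.
move=> ji; have [/is_iter_oreE[_ dE] <-] := io; rewrite ?mem_enum //.
apply: dE; rewrite ?mem_enum //; apply: iter_ore_sum_var.
  exact/subalgebra_subring/scalars_subalgebra.
by rewrite mem_take_enum.
Qed.

Lemma iter_ore_bracket_mx i j :
  bracket (x i) (x j) = (antisym_mx lambda i j)%:A.
Proof.
rewrite mxE; case: (ltngtP j i) => [ji|ij|/val_inj ->].
- exact: iter_ore_bracket.
- by rewrite bracketC iter_ore_bracket // scaleNr.
- by rewrite /bracket subrr scale0r.
Qed.

Lemma iter_ore_generated : generated x = setT.
Proof.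
have [/is_iter_oreE[AE _] _] := io.
apply/seteqP; split=> // a _; have : [set: A] a by [].
rewrite AE; apply: iter_ore_sum_min (generated_subalgebra _) _ _.
  by move=> r; apply: scalars_sub; apply: generated_subalgebra.
by move=> i _; apply: generated_gen.
Qed.

(** By the Taylor expansions, the algebra built before step [k] consists of the
    common constants of the [delta j] with [j >= k]. *)
Lemma iter_ore_constants delta : lnd_family delta -> kronecker delta x ->
  forall (k : 'I_s) r, constants delta [pred j : 'I_s | (j < k)%N] r ->
     x k * r - r * x k = d k r.
Proof.
move=> lnd kr k r rC; have [/is_iter_oreE[_ dE] _] := io.
apply: dE; rewrite ?mem_enum // (iter_ore_sum_scalars lnd kr) ?take_uniq ?enum_uniq //.
by move=> j; rewrite /= mem_take_enum => jk; apply: rC.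
Qed.

End FromOre.

(** The common kernel is [K] because the algebra is spanned by ordered monomials,
    whose variables the derivations remove one by one. Commutation and local
    nilpotency hold on the generators and pass to the algebra they generate, and
    [x i] distinguishes the intersections that use [delta i]. *)
Lemma lnd_of_generators (x : 'I_s -> A) delta (M : 'M[K]_s) :
  (forall i, kderivation (delta i)) -> kronecker delta x ->
  (forall i j, bracket (x i) (x j) = (M i j)%:A) -> generated x = setT ->
  lnd_family delta.
Proof.
move=> dd kr xx gx.
have gen B : subalgebra B -> (forall i, B (x i)) -> forall a, B a.
  by move=> Ba Bx a; have : generated x a by [rewrite gx]; apply.
have sys : ore_system x (@scalars K A) (enum 'I_s).
  have Sr := subalgebra_subring (scalars_subalgebra A).
  split=> // [i _ _ [k _ <-]|i j _ _]; rewrite -/(bracket _ _).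
    by rewrite bracket_scalar; apply: subring0.
  by rewrite xx; apply: scalar_in.
have [Is Ik Ix] := iter_ore_sum_subring sys.
have IT a : iter_ore_sum x (@scalars K A) (enum 'I_s) a.
  apply: gen => [|i]; last by apply: Ix; rewrite mem_enum.
  by apply: subring_subalgebra => // k; apply/Ik/scalar_in.
have cap : \bigcap_i derker (delta i) = @scalars K A.
  apply/seteqP; split=> [a aK|_ [k _ <-] i _]; last exact: kder_scalar.
  apply: (iter_ore_sum_ker charK0 dd (enum_uniq _) sys _ _ (IT a)) => //.
  - by move=> i _ _ [k _ <-]; apply: kder_scalar.
  - by move=> i _; apply: aK.
split=> //.
- move=> i; apply: gen => [|j]; first exact: nilpotent_subalgebra.
  exists 2; rewrite /= kr; case: (i == j); [exact: kder1 | exact: kder0].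
- by move=> i; exists (x i); rewrite kr eqxx oner_neq0.
- move=> i j; apply: gen => [|k]; first exact: kder_comm_subalgebra.
  by rewrite /= !kr; do 2![case: (_ == _)]; rewrite ?kder1 ?kder0.
move=> I J IJ; apply/setP => i.
have xI (L : {set 'I_s}) :
    (\bigcap_(k in [set` L]) derker (delta k)) (x i) <-> i \notin L.
  split=> [xL|iL k kL].
    apply/negP => /xL; rewrite /derker /= kr eqxx => /eqP.
    by rewrite (negbTE (oner_neq0 A)).
  rewrite /derker /=; apply: kronecker_kder0 kr _.
  by apply: contraNneq iL => <-.
by apply/idP/idP => iL; apply: contraLR iL => /xI; [rewrite -IJ|rewrite IJ] => /xI.
Qed.

End Families.

(** * Tensor products and polynomial algebras *)

Section TensorProducts.
Variables (K : fieldType) (B C : algType K).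
Local Notation T := (tensor B C).

Lemma pure_tensorDl b b' c :
  pure_tensor (b + b') c = pure_tensor b c + pure_tensor b' c :> T.
Proof. by rewrite -tens_classD; apply/tens_classP/tens_pureDl. Qed.

Lemma pure_tensorDr b c c' :
  pure_tensor b (c + c') = pure_tensor b c + pure_tensor b c' :> T.
Proof. by rewrite -tens_classD; apply/tens_classP/tens_pureDr. Qed.

Lemma pure_tensorZl k b c : pure_tensor (k *: b) c = k *: pure_tensor b c :> T.
Proof. by rewrite -tens_classZ; apply/tens_classP/tens_pureZl. Qed.

Lemma pure_tensorZr k b c : pure_tensor b (k *: c) = k *: pure_tensor b c :> T.
Proof. by rewrite -tens_classZ; apply/tens_classP/tens_pureZr. Qed.

Lemma pure_tensorM b b' c c' :
  pure_tensor b c * pure_tensor b' c' = pure_tensor (b * b') (c * c') :> T.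
Proof. by rewrite [LHS]tens_mulfE. Qed.

Lemma pure_tensor11 : pure_tensor 1 1 = 1 :> T.
Proof. by []. Qed.

Lemma tensor_ind (P : T -> Prop) :
  (forall b c, P (pure_tensor b c)) -> (forall k a, P a -> P (k *: a)) ->
  (forall a b, P a -> P b -> P (a + b)) -> forall a, P a.
Proof.
move=> Pp PZ PD a; rewrite -(tens_reprK a).
elim: (tens_repr a) => [b c||t Pt u Pu|k t Pt].
- exact: Pp.
- by rewrite tens_class0 -(scale0r (pure_tensor 1 1)); apply/PZ/Pp.
- by rewrite tens_classD; apply: PD.
- by rewrite tens_classZ; apply: PZ.
Qed.

Section Lift.
Variables (V : lmodType K) (beta : B -> C -> V).
Hypotheses (beta_l : forall c, linear (beta^~ c)) (beta_r : forall b, linear (beta b)).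

Fixpoint texpr_eval (t : texpr K B C) : V :=
  match t with
  | TPure b c => beta b c
  | TZero => 0
  | TAdd t u => texpr_eval t + texpr_eval u
  | TScale k t => k *: texpr_eval t
  end.

Lemma texpr_eval_eq t u : tens_eq t u -> texpr_eval t = texpr_eval u.
Proof.
elim=> {t u} //=.
- by move=> t u v _ -> _ ->.
- by move=> t t' u u' _ -> _ ->.
- by move=> k t t' _ ->.
- by move=> *; rewrite addrA.
- by move=> *; rewrite addrC.
- by move=> *; rewrite add0r.
- by move=> *; rewrite scaleN1r addNr.
- by move=> *; rewrite scalerA.
- by move=> *; rewrite scale1r.
- by move=> *; rewrite scalerDr.
- by move=> *; rewrite scalerDl.
- by move=> *; rewrite (linear_add (beta_l _)).
- by move=> *; rewrite (linear_add (beta_r _)).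
- by move=> *; rewrite (linear_scale (beta_l _)).
- by move=> *; rewrite (linear_scale (beta_r _)).
Qed.

Definition tens_lift (a : T) : V := texpr_eval (tens_repr a).

Lemma tens_liftE t : tens_lift (tens_class t) = texpr_eval t.
Proof. exact/texpr_eval_eq/tens_repr_class. Qed.

Lemma tens_lift_pure b c : tens_lift (pure_tensor b c) = beta b c.
Proof. exact: tens_liftE. Qed.

Lemma tens_lift_linear : linear tens_lift.
Proof.
move=> k; elim/tensW=> t; elim/tensW=> u.
by rewrite -tens_classZ -tens_classD !tens_liftE.
Qed.

End Lift.

(** Two morphisms with commuting images combine into a morphism on the tensor
    product. *)
Lemma tens_lift_monoid (A : algType K) (phi : B -> A) (psi : C -> A)
  (beta_l : forall c, linear (fun b => phi b * psi c))
  (beta_r : forall b, linear (fun c => phi b * psi c)) :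
  monoid_morphism phi -> monoid_morphism psi ->
  (forall b c, psi c * phi b = phi b * psi c) ->
  monoid_morphism (tens_lift (fun b c => phi b * psi c)).
Proof.
move=> [phi1 phiM] [psi1 psiM] comm.
have fl := tens_lift_linear beta_l beta_r.
have fp := tens_lift_pure beta_l beta_r.
split; first by rewrite -pure_tensor11 fp phi1 psi1 mulr1.
elim/tensor_ind=> [b c|k a IH|a a' IH IH'] u.
- elim/tensor_ind: u => [b' c'|k u IH|u u' IH IH'].
  + rewrite pure_tensorM !fp phiM psiM -!mulrA; congr (_ * _).
    by rewrite !mulrA comm.
  + by rewrite -tens_scaleAr !(linear_scale fl) IH scalerAr.
  + by rewrite mulrDr !(linear_add fl) IH IH' mulrDr.
- by rewrite -tens_scaleAl !(linear_scale fl) IH scalerAl.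
- by rewrite mulrDl !(linear_add fl) IH IH' mulrDl.
Qed.

End TensorProducts.

Section PolynomialSubalgebra.
Variables (K : fieldType) (A : algType K) (m : nat) (z : 'I_m -> A).
Hypothesis zC : forall i j, z i * z j = z j * z i.

(** Evaluation at elements that commute with each other but need not be central
    in [A]. *)
Definition mpoly_at (p : {mpoly K[m]}) : A := mmap (in_alg A) z p.

Lemma mpoly_at_linear : linear mpoly_at.
Proof. by move=> k p q; rewrite /mpoly_at mmapD mmapZ /= mulr_algl. Qed.

Lemma mpoly_atX i : mpoly_at 'X_i = z i.
Proof. by rewrite /mpoly_at mmapX mmap1U. Qed.

Lemma mmap1D (a b : 'X_{1..m}) : mmap1 z (a + b) = mmap1 z a * mmap1 z b.
Proof.
rewrite /mmap1 -prodrM_comm; first by apply: eq_bigr => i _; rewrite mnmDE exprD.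
by move=> i j _ _; apply: commrX; apply/commr_sym/commrX/zC.
Qed.

Lemma mpoly_at_monoid : monoid_morphism mpoly_at.
Proof.
split=> [|p q]; first by rewrite /mpoly_at -mpolyC1 mmapC /= scale1r.
rewrite /mpoly_at [in LHS](mpolyE p) [in RHS](mpolyE p) mulr_suml !raddf_sum mulr_suml /=.
apply: eq_bigr => a _; rewrite -scalerAl !mmapZ -mulrA; congr (_ * _).
rewrite [in LHS](mpolyE q) [in RHS](mpolyE q) mulr_sumr !raddf_sum mulr_sumr /=.
apply: eq_bigr => b _; rewrite -scalerAr !mmapZ -mpolyXD !mmapX mmap1D.
by rewrite /= !mulr_algl scalerAr.
Qed.

Lemma mpoly_ind_gen (P : {mpoly K[m]} -> Prop) :
  (forall k, P k%:A) -> (forall i, P 'X_i) ->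
  (forall a b, P a -> P b -> P (a + b)) ->
  (forall a b, P a -> P b -> P (a * b)) -> forall p, P p.
Proof.
move=> Pk PX PD PM p; rewrite (mpolyE p).
have P0 : P 0 by rewrite -(scale0r 1).
have P1 : P 1 by rewrite -(scale1r 1).
apply: (big_ind P) => // a _; rewrite -mulr_algl; apply/(PM _ _ (Pk _)).
rewrite mpolyXE_id; apply: (big_ind P) => // i _.
by elim: (a i) => [|n IH]; rewrite ?expr0 // exprS; apply: (PM _ _ (PX _)).
Qed.

End PolynomialSubalgebra.

(** * Realisations of A_n (x) P_m *)

Section WeylPolynomial.
Variables (K : fieldType) (n m : nat).
Local Notation W := (weyl K n).
Local Notation P := {mpoly K[m]}.
Local Notation T := (tensor W P).
Local Notation I := (('I_n + 'I_n) + 'I_m)%type.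
Implicit Types (a b : I).

Definition wgen (w : 'I_n + 'I_n) : W := pres_gen (@weyl_rel K n) w.

Definition tgen a : T :=
  match a with inl w => pure_tensor (wgen w) 1 | inr j => pure_tensor 1 'X_j end.

(** The values of the brackets of the generators. The index [inl (inl i)] stands
    for [q_i], [inl (inr i)] for [p_i], and [inr j] for the [j]-th polynomial
    variable. *)
Definition weyl_form a b : K :=
  match a, b with
  | inl (inr i), inl (inl j) => (i == j)%:R
  | inl (inl i), inl (inr j) => - (i == j)%:R
  | _, _ => 0
  end.

Lemma wgen_pq i j :
  wgen (inr i) * wgen (inl j) = wgen (inl j) * wgen (inr i) + (i == j)%:R%:A.
Proof.
rewrite -[_%:A]pres_class_cst /wgen /pres_gen -!pres_classM -pres_classD.
exact/pres_classP/pres_rel/weyl_pq.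
Qed.

Lemma wgen_pp i j : wgen (inr i) * wgen (inr j) = wgen (inr j) * wgen (inr i).
Proof.
by rewrite /wgen /pres_gen -!pres_classM; apply/pres_classP/pres_rel/weyl_pp.
Qed.

Lemma wgen_qq i j : wgen (inl i) * wgen (inl j) = wgen (inl j) * wgen (inl i).
Proof.
by rewrite /wgen /pres_gen -!pres_classM; apply/pres_classP/pres_rel/weyl_qq.
Qed.

Lemma tgen_bracket a b :
  tgen a * tgen b - tgen b * tgen a = weyl_form a b *: (1 : T).
Proof.
have TE (w w' : 'I_n + 'I_n) : tgen (inl w) * tgen (inl w') - tgen (inl w') * tgen (inl w)
    = pure_tensor (wgen w * wgen w' - wgen w' * wgen w) 1.
  by rewrite !pure_tensorM !mulr1 -scaleN1r -pure_tensorZl -pure_tensorDl scaleN1r.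
have p0 : pure_tensor 0 1 = 0 :> T by rewrite -(scale0r 1) pure_tensorZl scale0r.
case: a b => [[i|i]|i] [[j|j]|j]; rewrite ?TE /=.
- by rewrite wgen_qq subrr p0 scale0r.
- rewrite wgen_pq opprD addNKr -scaleNr pure_tensorZl pure_tensor11 eq_sym.
  by [].
- by rewrite pure_tensorM !mul1r !mulr1 pure_tensorM !mul1r !mulr1 subrr scale0r.
- by rewrite wgen_pq addrC addKr pure_tensorZl.
- by rewrite wgen_pp subrr p0 scale0r.
- by rewrite pure_tensorM !mul1r !mulr1 pure_tensorM !mul1r !mulr1 subrr scale0r.
- by rewrite pure_tensorM !mul1r !mulr1 pure_tensorM !mul1r !mulr1 subrr scale0r.
- by rewrite pure_tensorM !mul1r !mulr1 pure_tensorM !mul1r !mulr1 subrr scale0r.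
- by rewrite !pure_tensorM mulrC subrr scale0r.
Qed.

Lemma weyl_poly_ind (Q : T -> Prop) :
  (forall k, Q (k *: (1 : T))) -> (forall a, Q (tgen a)) ->
  (forall u v, Q u -> Q v -> Q (u + v)) ->
  (forall u v, Q u -> Q v -> Q (u * v)) -> forall t, Q t.
Proof.
move=> Qk Qg QD QM; elim/tensor_ind=> [b c|k t Qt|t u Qt Qu]; last exact: QD.
  have -> : pure_tensor b c = pure_tensor b 1 * pure_tensor 1 c :> T.
    by rewrite pure_tensorM mulr1 mul1r.
  apply: (QM).
    elim/presented_ind: b => [k|w|b b' Qb Qb'|b b' Qb Qb'].
    - by rewrite pure_tensorZl pure_tensor11.
    - exact: (Qg (inl w)).
    - by rewrite pure_tensorDl; apply: QD.
    - by rewrite -[1]mulr1 -pure_tensorM; apply: QM.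
  elim/mpoly_ind_gen: c => [k|j|c c' Qc Qc'|c c' Qc Qc'].
  - by rewrite pure_tensorZr pure_tensor11.
  - exact: (Qg (inr j)).
  - by rewrite pure_tensorDr; apply: QD.
  - by rewrite -[1]mulr1 -pure_tensorM; apply: QM.
by rewrite -[t]mul1r tens_scaleAl; apply: QM.
Qed.

Definition tens_scalars : set T := [set t | exists k, t = k *: (1 : T)].

Lemma tens_scalars_subring : subring tens_scalars.
Proof.
split=> [|_ _ [k ->] [l ->]|_ _ [k ->] [l ->]].
- by exists 1; rewrite scale1r.
- by exists (k - l); rewrite scalerBl.
- by exists (k * l); rewrite -tens_scaleAl mul1r scalerA.
Qed.

Lemma tens_system : ore_system tgen tens_scalars (enum {: I}).
Proof.
split=> [|a _ _ [k ->]|a b _ _]; first exact: tens_scalars_subring.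
  exists 0; rewrite scale0r -tens_scaleAr -tens_scaleAl mul1r mulr1.
  exact: subrr.
by exists (weyl_form a b); apply: tgen_bracket.
Qed.

(** The spanning half of the Poincare-Birkhoff-Witt theorem. *)
Lemma tens_iter_ore_sum t : iter_ore_sum tgen tens_scalars (enum {: I}) t.
Proof.
have [Is Ik Ig] := iter_ore_sum_subring tens_system.
apply: weyl_poly_ind => [k|a|u v|u v].
- by apply: Ik; exists k.
- by apply: Ig; rewrite mem_enum.
- exact: subringD.
- exact: subringM.
Qed.

Section Realisation.
Variables (A : algType K) (y : I -> A).
Hypothesis yy : forall a b, bracket (y a) (y b) = (weyl_form a b)%:A.

Let yyD a b : y a * y b = y b * y a + (weyl_form a b)%:A.
Proof. by rewrite -yy /bracket addrC subrK. Qed.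

Let yC a b : weyl_form a b = 0 -> y a * y b = y b * y a.
Proof. by move=> ab; rewrite yyD ab scale0r addr0. Qed.

Let at_monoid : monoid_morphism (mpoly_at (fun j => y (inr j))).
Proof. by apply: mpoly_at_monoid => i j; apply: yC. Qed.

Lemma weyl_real_rel t u : weyl_rel t u ->
  expr_eval (fun w => y (inl w)) t = expr_eval (fun w => y (inl w)) u.
Proof.
case=> i j /=; first by rewrite yyD.
  by rewrite yC.
by rewrite yC.
Qed.

Definition weyl_real : W -> A := pres_lift (fun w => y (inl w)).

Lemma weyl_poly_comm (b : W) (c : P) :
  mpoly_at (fun j => y (inr j)) c * weyl_real b =
  weyl_real b * mpoly_at (fun j => y (inr j)) c.
Proof.
have ml := mpoly_at_linear (fun j => y (inr j)).
have [m1 mM] := at_monoid.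
have pl := pres_lift_linear weyl_real_rel.
have [p1 pM] := pres_lift_monoid weyl_real_rel.
elim/mpoly_ind_gen: c => [k|j|c c' IH IH'|c c' IH IH'].
- by rewrite !(linear_scale ml) m1 -scalerAl -scalerAr mul1r mulr1.
- rewrite mpoly_atX /weyl_real.
  elim/presented_ind: b => [k|w|b b' IH IH'|b b' IH IH'].
  + by rewrite !(linear_scale pl) p1 -scalerAl -scalerAr mul1r mulr1.
  + by rewrite pres_lift_gen; [apply: yC | apply: weyl_real_rel].
  + by rewrite !(linear_add pl) mulrDl mulrDr IH IH'.
  + by rewrite !pM mulrA IH -mulrA IH' mulrA.
- by rewrite !(linear_add ml) mulrDl mulrDr IH IH'.
- by rewrite !mM -mulrA IH' mulrA IH mulrA.
Qed.

Definition weyl_poly_real : T -> A :=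
  tens_lift (fun (b : W) (c : P) => weyl_real b * mpoly_at (fun j => y (inr j)) c).

Let real_l c : linear (fun b : W => weyl_real b * mpoly_at (fun j => y (inr j)) c).
Proof.
by move=> k b b'; rewrite {1}/weyl_real (pres_lift_linear weyl_real_rel) mulrDl scalerAl.
Qed.

Let real_r (b : W) : linear (fun c : P => weyl_real b * mpoly_at (fun j => y (inr j)) c).
Proof. by move=> k c c'; rewrite mpoly_at_linear mulrDr scalerAr. Qed.

Lemma weyl_poly_real_linear : linear weyl_poly_real.
Proof. exact: tens_lift_linear real_l real_r. Qed.

Lemma weyl_poly_real_monoid : monoid_morphism weyl_poly_real.
Proof.
apply: tens_lift_monoid real_l real_r _ _ _.
- exact: pres_lift_monoid weyl_real_rel.
- exact: at_monoid.
- exact: weyl_poly_comm.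
Qed.

Lemma weyl_poly_real_gen a : weyl_poly_real (tgen a) = y a.
Proof.
rewrite /weyl_poly_real; case: a => [w|j] /=; rewrite tens_lift_pure //.
  rewrite /weyl_real (pres_lift_gen weyl_real_rel).
  by have [-> _] := at_monoid; rewrite mulr1.
rewrite /weyl_real; have [-> _] := pres_lift_monoid weyl_real_rel.
by rewrite mul1r mpoly_atX.
Qed.

(** The derivations [d a] separate the monomials in the [y a], so the [y a]
    satisfy no relations besides those of [A_n (x) P_m]. *)
Lemma weyl_poly_iso (charK0 : [pchar K] =i pred0) (d : I -> A -> A) :
  (forall a, kderivation (d a)) ->
  (forall a b, d a (y b) = (a == b)%:R) -> iso_weyl_poly n m (generated y).
Proof.
move=> dd dy.
pose f := rmorph_pack (linear_zmod weyl_poly_real_linear) weyl_poly_real_monoid.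
have fg a : f (tgen a) = y a := weyl_poly_real_gen a.
have fk k : f (k *: (1 : T)) = k%:A.
  have <- : f 1 = 1 := rmorph1 f.
  exact: (linear_scale weyl_poly_real_linear).
exists f; split=> //.
- exact: weyl_poly_real_linear.
- exact: weyl_poly_real_monoid.
- apply: raddf_inj => t ft0.
  apply: (iter_ore_sum_inj charK0 dd (enum_uniq _) tens_system _ _ _
    (tens_iter_ore_sum t) ft0).
  + by move=> a _ _ [k ->]; rewrite fk kder_scalar.
  + by move=> a b _ _; rewrite fg dy.
  + move=> _ [k ->]; rewrite fk => /eqP; rewrite scaler_eq0 oner_eq0 orbF => /eqP ->.
    by rewrite scale0r.
apply/seteqP; split=> [_ [t _ <-]|v gv].
  have Gs := generated_subalgebra y; have [_ GD GM _] := Gs.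
  elim/weyl_poly_ind: t => [k|a|t u Gt Gu|t u Gt Gu].
  - by rewrite fk; apply: subalgebra_scalar.
  - by rewrite fg; apply: generated_gen.
  - by rewrite rmorphD; apply: GD.
  - by rewrite rmorphM; apply: GM.
apply: gv => [|a]; last by exists (tgen a).
split=> [|_ _ [t _ <-] [u _ <-]|_ _ [t _ <-] [u _ <-]|k _ [t _ <-]].
- by exists 1; rewrite ?rmorph1.
- by exists (t + u); rewrite ?rmorphD.
- by exists (t * u); rewrite ?rmorphM.
- by exists (k *: t); rewrite //; apply: (linear_scale weyl_poly_real_linear).
Qed.

End Realisation.
End WeylPolynomial.

(** * Derivations and centre of A_n (x) P_m *)

Section WeylPolynomialStructure.
Variables (K : fieldType) (charK0 : [pchar K] =i pred0) (A : algType K).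
Variables (n m : nat).
Local Notation T := (tensor (weyl K n) {mpoly K[m]}).
Local Notation I := (('I_n + 'I_n) + 'I_m)%type.
Variable f : T -> A.
Hypotheses (fl : linear f) (fm : monoid_morphism f) (fI : injective f).
Hypothesis fT : range f = setT.

Let y (a : I) : A := f (tgen K a).
Let fpoly (p : {mpoly K[m]}) : A := f (pure_tensor 1 p).

Let FZ k : {morph f : t / k *: t}. Proof. exact: (linear_scale fl). Qed.
Let FD : {morph f : t u / t + u}. Proof. exact: (linear_add fl). Qed.
Let FB : {morph f : t u / t - u}. Proof. exact: (linear_zmod fl). Qed.
Let FM : {morph f : t u / t * u}. Proof. by case: fm. Qed.
Let F1 : f 1 = 1. Proof. by case: fm. Qed.

Lemma fpoly_zmod : zmod_morphism fpoly.
Proof.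
apply: linear_zmod => k p q.
by rewrite /fpoly pure_tensorDr pure_tensorZr FD FZ.
Qed.

Lemma fpoly_monoid : monoid_morphism fpoly.
Proof.
split=> [|p q]; first by rewrite /fpoly pure_tensor11 F1.
by rewrite /fpoly -[1 in LHS]mulr1 -pure_tensorM FM.
Qed.

Let Fp := rmorph_pack fpoly_zmod fpoly_monoid.

Let FpE p : Fp p = f (pure_tensor 1 p). Proof. by []. Qed.

Let FpX j : Fp 'X_j = y (inr j). Proof. by []. Qed.

Let Fpk k : Fp k%:A = k%:A.
Proof. by rewrite FpE pure_tensorZr FZ pure_tensor11 F1. Qed.

Lemma iso_bracket a b : bracket (y a) (y b) = (weyl_form K a b)%:A.
Proof. by rewrite /bracket -!FM -FB tgen_bracket FZ F1. Qed.

Lemma iso_ind (Q : set A) : subalgebra Q -> (forall a, Q (y a)) -> forall u, Q u.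
Proof.
move=> Qs Qy u; have [_ QD QM _] := Qs.
have [t _ <-] : range f u by rewrite fT.
elim/weyl_poly_ind: t => [k|a|t v Qt Qv|t v Qt Qv] //.
- by rewrite FZ F1; apply: subalgebra_scalar.
- exact: Qy.
- by rewrite FD; apply: QD.
- by rewrite FM; apply: QM.
Qed.

Let finv_ex : {g : A -> T | forall u, f (g u) = u}.
Proof.
suff /choice[g gE] : forall u, exists t, f t = u by exists g.
by move=> u; have [t _ <-] : range f u; [rewrite fT | exists t].
Qed.

Let finv := sval finv_ex.
Let finvK u : f (finv u) = u. Proof. exact: (svalP finv_ex). Qed.
Let FK t : finv (f t) = t. Proof. exact/fI/finvK. Qed.

Let pderiv_t j : T -> A :=
  tens_lift (fun (b : weyl K n) (c : {mpoly K[m]}) => f (pure_tensor b c^`M(j))).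

Let pderiv_l j c : linear (fun b : weyl K n => f (pure_tensor b c^`M(j))).
Proof. by move=> k b b'; rewrite pure_tensorDl pure_tensorZl FD FZ. Qed.

Let pderiv_r j (b : weyl K n) :
  linear (fun c : {mpoly K[m]} => f (pure_tensor b c^`M(j))).
Proof.
by move=> k c c'; rewrite mderivD mderivZ pure_tensorDr pure_tensorZr FD FZ.
Qed.

(** The partial derivative [1 (x) d/dX_j], carried over to [A]. *)
Definition iso_pderiv j (u : A) : A := pderiv_t j (finv u).

Let pderiv_tE j b c : pderiv_t j (pure_tensor b c) = f (pure_tensor b c^`M(j)).
Proof. exact: (tens_lift_pure (pderiv_l j) (pderiv_r j)). Qed.

Lemma iso_pderivE j b c :
  iso_pderiv j (f (pure_tensor b c)) = f (pure_tensor b c^`M(j)).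
Proof. by rewrite /iso_pderiv FK pderiv_tE. Qed.

Lemma iso_pderiv_kder j : kderivation (iso_pderiv j).
Proof.
have pl : linear (pderiv_t j) := tens_lift_linear (pderiv_l j) (pderiv_r j).
have finvD k u v : finv (k *: u + v) = k *: finv u + finv v.
  by apply: fI; rewrite fl !finvK.
have finvM u v : finv (u * v) = finv u * finv v.
  by apply: fI; rewrite FM !finvK.
have pM t t' : pderiv_t j (t * t') = pderiv_t j t * f t' + f t * pderiv_t j t'.
  elim/tensor_ind: t => [b c|k t IH|t u IH IH'].
  - elim/tensor_ind: t' => [b' c'|k t IH|t u IH IH'].
    + rewrite pure_tensorM !pderiv_tE -!FM !pure_tensorM -FD.
      by rewrite -pure_tensorDr mderivM.
    + by rewrite -tens_scaleAr !(linear_scale pl) IH FZ scalerDr !scalerAr.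
    + by rewrite mulrDr !(linear_add pl) IH IH' FD !mulrDr addrACA.
  - by rewrite -tens_scaleAl !(linear_scale pl) IH FZ scalerDr !scalerAl.
  - by rewrite mulrDl !(linear_add pl) IH IH' FD !mulrDl addrACA.
by split=> [k u v|u v]; rewrite /iso_pderiv ?finvD ?pl // finvM pM !finvK.
Qed.

(** The coordinate derivations: [q_i] is differentiated by the bracket with
    [p_i], and [p_i] by the bracket with [- q_i]. *)
Definition iso_deriv (a : I) : A -> A :=
  match a with
  | inl (inl i) => bracket (y (inl (inr i)))
  | inl (inr i) => bracket (- y (inl (inl i)))
  | inr j => iso_pderiv j
  end.

Lemma iso_deriv_kder a : kderivation (iso_deriv a).
Proof.
case: a => [[i|i]|j] /=; [exact: bracket_kder | exact: bracket_kder |].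
exact: iso_pderiv_kder.
Qed.

Lemma bracketNl (u v : A) : bracket (- u) v = - bracket u v.
Proof. by rewrite /bracket mulNr mulrN opprB opprK addrC. Qed.

Lemma iso_deriv_gen a b : iso_deriv a (y b) = (a == b)%:R.
Proof.
have mXi (i j : 'I_m) : 'X_i^`M(j) = ((i == j)%:R)%:A :> {mpoly K[m]}.
  rewrite mderivX mnm1E; case: eqVneq => [->|_]; last by rewrite !scale0r.
  suff -> : (U_(j) - U_(j) = 0)%MM by rewrite mpolyX0.
  by apply/mnmP => k; rewrite mnmBE subnn mnm0E.
case: a b => [[i|i]|i] [[j|j]|j] /=; rewrite ?bracketNl ?iso_bracket /=;
  rewrite ?scale0r ?scaleNr ?opprK ?oppr0 ?scaler_nat //.
- rewrite /y /= iso_pderivE -mpolyC1 mderivC.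
  by rewrite -(scale0r 1) pure_tensorZr FZ scale0r.
- rewrite /y /= iso_pderivE -mpolyC1 mderivC.
  by rewrite -(scale0r 1) pure_tensorZr FZ scale0r.
- by rewrite /y /= iso_pderivE mXi pure_tensorZr FZ F1 scaler_nat eq_sym.
Qed.

(** The coordinate derivations of the generators, renumbered, fulfil the
    hypotheses of [lnd_of_generators]. *)
Lemma iso_weyl_poly_lnd s : (2 * n + m)%N = s -> cond_lnd A s.
Proof.
move=> nms; have cardI : #|{: I}| = s by rewrite !card_sum !card_ord addnn -mul2n.
pose e (i : 'I_s) : I := enum_val (cast_ord (esym cardI) i).
have eI : injective e by move=> i j /enum_val_inj/cast_ord_inj.
exists (fun i => iso_deriv (e i)).
apply: (lnd_of_generators charK0 (x := fun i => y (e i))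
   (M := \matrix_(i, j) weyl_form K (e i) (e j))).
- by move=> i; apply: iso_deriv_kder.
- by move=> i j; rewrite iso_deriv_gen (inj_eq eI).
- by move=> i j; rewrite iso_bracket mxE.
apply/seteqP; split=> // u _; apply: iso_ind => [|a].
  exact: generated_subalgebra.
have -> : a = e (cast_ord cardI (enum_rank a)) by rewrite /e cast_ordK enum_rankK.
exact: (@generated_gen _ _ _ (fun i => y (e i))).
Qed.

Definition central (u : A) := forall v, u * v = v * u.

Lemma iso_poly_central p : central (Fp p).
Proof.
move=> v; move: v; apply: iso_ind => [|a].
  split=> [|u v /= cu cv|u v /= cu cv|k u /= cu].
  - by rewrite /= mulr1 mul1r.
  - by rewrite mulrDr mulrDl cu cv.
  - by rewrite mulrA cu -mulrA cv mulrA.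
  - by rewrite -scalerAr -scalerAl cu.
change (f (pure_tensor 1 p) * f (tgen K a) = f (tgen K a) * f (pure_tensor 1 p)).
rewrite -!FM; congr (f _).
case: a => [w|j] /=; rewrite !pure_tensorM ?mul1r ?mulr1 //.
by rewrite [_ * p]mulrC.
Qed.

(** A central element is killed by the brackets with the [p_i] and [q_i], which
    are the coordinate derivations for the [q_i] and [p_i] up to sign; so it
    involves the polynomial variables only. *)
Lemma iso_central_poly u : central u -> exists p, u = Fp p.
Proof.
move=> cu; pose R : set A := range Fp.
have Rr : subring R.
  split=> [|_ _ [p _ <-] [q _ <-]|_ _ [p _ <-] [q _ <-]].
  - by exists 1; rewrite ?rmorph1.
  - by exists (p - q); rewrite ?rmorphB.
  - by exists (p * q); rewrite ?rmorphM.
have sys : ore_system (fun w => y (inl w)) R (enum {: 'I_n + 'I_n}).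
  split=> // [w _ _ [p _ <-]|w w' _ _].
    by rewrite -iso_poly_central subrr; apply: subring0.
  by exists (weyl_form K (inl w : I) (inl w'))%:A; rewrite // Fpk -iso_bracket.
have [Is IR Iy] := iter_ore_sum_subring sys.
have IA : forall v, iter_ore_sum (fun w => y (inl w)) R (enum {: 'I_n + 'I_n}) v.
  apply: iso_ind => [|[w|j]].
  - by apply: subring_subalgebra => // k; apply: IR; exists k%:A; rewrite ?Fpk.
  - by apply: Iy; rewrite mem_enum.
  - by apply: IR; exists 'X_j.
have [//|||p _ <-] := iter_ore_sum_ker (x := fun w => y (inl w)) charK0
    (fun w : 'I_n + 'I_n => iso_deriv_kder (inl w)) (enum_uniq _) sys _ _ (IA u).
- move=> [i|i] _ _ [p _ <-] /=.
    by rewrite /bracket -iso_poly_central subrr.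
  by rewrite bracketNl /bracket -iso_poly_central subrr oppr0.
- by move=> w w' _ _; rewrite iso_deriv_gen.
- move=> [i|i] _ /=; first by rewrite /bracket cu subrr.
  by rewrite bracketNl /bracket cu subrr oppr0.
by exists p.
Qed.

Lemma kder_central (D : A -> A) u : kderivation D -> central u -> central (D u).
Proof.
move=> dD cu v; apply: (addrI (u * D v)).
by rewrite addrC -(kderM dD) cu (kderM dD) cu addrC.
Qed.

Lemma iso_poly_inj : injective Fp.
Proof.
have sys : ore_system (fun j => 'X_j) [set p | exists k : K, p = k%:A :> {mpoly K[m]}]
    (enum 'I_m).
  split=> [|i _ _ [k ->]|i j _ _]; try by exists 0; rewrite mulrC subrr scale0r.
  split=> [|_ _ [k ->] [l ->]|_ _ [k ->] [l ->]].
  - by exists 1; rewrite scale1r.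
  - by exists (k - l); rewrite scalerBl.
  - by exists (k * l); rewrite -scalerAl mul1r scalerA.
have [Is IR IX] := iter_ore_sum_subring sys.
apply: raddf_inj => p Fp0.
apply: (iter_ore_sum_inj charK0 (fun j : 'I_m => iso_deriv_kder (inr j))
  (enum_uniq _) sys _ _ _ _ Fp0).
- by move=> j _ _ [k ->]; rewrite Fpk kder_scalar //; apply: iso_deriv_kder.
- by move=> i j _ _; rewrite FpX iso_deriv_gen.
- move=> _ [k ->]; rewrite Fpk => /eqP.
  by rewrite scaler_eq0 oner_eq0 orbF => /eqP ->; rewrite scale0r.
elim/mpoly_ind_gen: p {Fp0} => [k|j|p q|p q].
- by apply: IR; exists k.
- by apply: IX; rewrite mem_enum.
- exact: subringD.
- exact: subringM.
Qed.

(** Both sides are derivations in [p] that agree on the variables. The product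
    rule for the right-hand side uses that [Fp p] is central. *)
Lemma iso_poly_chain (D : A -> A) p : kderivation D ->
  D (Fp p) = \sum_j Fp p^`M(j) * D (y (inr j)).
Proof.
move=> dD; elim/mpoly_ind_gen: p => [k|i|p q IHp IHq|p q IHp IHq].
- rewrite Fpk kder_scalar // big1 // => j _.
  by rewrite mderivZ -mpolyC1 mderivC scaler0 rmorph0 mul0r.
- rewrite FpX (bigD1 i) // big1 => [|j ji].
    rewrite mderivX mnm1E eqxx scale1r.
    suff -> : (U_(i) - U_(i) = 0)%MM by rewrite mpolyX0 (rmorph1 Fp) mul1r /= addr0.
    by apply/mnmP => k; rewrite mnmBE subnn mnm0E.
  by rewrite mderivX mnm1E eq_sym (negbTE ji) scale0r rmorph0 mul0r.
- rewrite rmorphD (kderD dD) IHp IHq -big_split; apply: eq_bigr => j _.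
  by rewrite mderivD rmorphD mulrDl.
- rewrite rmorphM (kderM dD) IHp IHq mulr_suml mulr_sumr -big_split.
  apply: eq_bigr => j _; rewrite mderivM rmorphD !rmorphM mulrDl /= -!mulrA.
  congr (_ + _); congr (_ * _).
  by rewrite iso_poly_central.
Qed.

(** By the chain rule, the Jacobian matrix of the central elements [u i] with
    respect to the polynomial variables has a one-sided inverse, with entries in
    a nonzero commutative ring. Hence there are at most [m] of them. *)
Lemma iso_central_le k (u : 'I_k -> A) (D : 'I_k -> A -> A) :
  (forall i, kderivation (D i)) -> (forall i, central (u i)) ->
  (forall i j, D i (u j) = (i == j)%:R) -> (k <= m)%N.
Proof.
move=> dD cu Du.
have /choice[g gE] : forall i, exists p, u i = Fp p by move=> i; apply: iso_central_poly.
have /choice[h hE] : forall ij : 'I_k * 'I_m, exists p, D ij.1 (y (inr ij.2)) = Fp p.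
  move=> [i j]; apply: iso_central_poly; apply: kder_central => //.
  by rewrite -FpX; apply: iso_poly_central.
apply: (@mulmx1_min _ k m (\matrix_(i, j) h (i, j)) (\matrix_(j, i) (g i)^`M(j))).
apply/matrixP => i j; rewrite !mxE; apply: iso_poly_inj.
rewrite rmorph_sum rmorph_nat -Du gE iso_poly_chain //; apply: eq_bigr => l _.
by rewrite !mxE rmorphM (hE (i, l)) iso_poly_central.
Qed.

End WeylPolynomialStructure.

(** Either presentation provides central elements with coordinate derivations,
    whose number the other one bounds. *)
Lemma iso_weyl_poly_unique (K : fieldType) (charK0 : [pchar K] =i pred0)
    (A : algType K) n m n' m' :
  iso_weyl_poly n m [set: A] -> iso_weyl_poly n' m' [set: A] -> m = m'.
Proof.
suff le n1 m1 n2 m2 : iso_weyl_poly n1 m1 [set: A] ->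
    iso_weyl_poly n2 m2 [set: A] -> (m1 <= m2)%N.
  by move=> H H'; apply/eqP; rewrite eqn_leq (le _ _ _ _ H H') (le _ _ _ _ H' H).
move=> [f [fl fm fI fT]] [g [gl gm gI gT]].
apply: (iso_central_le charK0 gl gm gI gT
  (u := fun j => f (tgen K (inr j))) (D := fun j => iso_deriv fT (inr j))).
- by move=> j; apply: iso_deriv_kder.
- by move=> j; apply: iso_poly_central.
- by move=> i j; rewrite (iso_deriv_gen fl fm fI fT).
Qed.

(** * Normal form of alternating matrices *)

Section Darboux.
Variables (K : fieldType) (charK0 : [pchar K] =i pred0) (k : nat) (M : 'M[K]_k).
Hypothesis MT : M^T = - M.

Let B p q (U : 'M[K]_(p, k)) (V : 'M[K]_(q, k)) : 'M[K]_(p, q) := U *m M *m V^T.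

Let Btr p q (U : 'M_(p, k)) (V : 'M_(q, k)) : B U V = - (B V U)^T.
Proof. by rewrite /B !trmx_mul trmxK MT mulNmx mulmxN mulmxA opprK. Qed.

Let Bcol p1 p2 q1 q2 (U1 : 'M_(p1, k)) (U2 : 'M_(p2, k)) (V1 : 'M_(q1, k))
    (V2 : 'M_(q2, k)) :
  B (col_mx U1 U2) (col_mx V1 V2) =
  block_mx (B U1 V1) (B U1 V2) (B U2 V1) (B U2 V2).
Proof. by rewrite /B mul_col_mx tr_col_mx mul_col_row. Qed.

Let Bl p q r (X : 'M_(r, p)) (U : 'M_(p, k)) (V : 'M_(q, k)) :
  B (X *m U) V = X *m B U V.
Proof. by rewrite /B !mulmxA. Qed.

Let Br p q r (X : 'M_(r, q)) (U : 'M_(p, k)) (V : 'M_(q, k)) :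
  B U (X *m V) = B U V *m X^T.
Proof. by rewrite /B trmx_mul mulmxA. Qed.

Let BD p q (U U' : 'M_(p, k)) (V : 'M_(q, k)) : B (U + U') V = B U V + B U' V.
Proof. by rewrite /B !mulmxDl. Qed.

Let Bself (u : 'rV_k) : B u u = 0.
Proof.
apply/matrixP => i j; rewrite !ord1 mxE.
have /(congr1 (fun X : 'M_1 => X 0 0)) := Btr u u; rewrite !mxE => /eqP.
by rewrite -addr_eq0 -mulr2n => /eqP/(mulrn_eq0_char0 charK0 (A := K^o)).
Qed.

(** The rows of [P] and [Q] form [n] hyperbolic pairs for the alternating form of
    matrix [M]. *)
Definition hyperbolic n : Prop := exists Q P : 'M[K]_(n, k),
  [/\ B Q Q = 0, B P P = 0 & B P Q = 1%:M].

Definition std_symplectic n : 'M[K]_(n + n) := block_mx 0 (- 1%:M) 1%:M 0.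

Lemma std_symplectic_unit n : std_symplectic n \in unitmx.
Proof.
suff /mulmx1_unit[] : std_symplectic n *m block_mx 0 1%:M (- 1%:M) 0 = 1%:M by [].
rewrite mulmx_block !mul0mx !mulmx0 mulNmx mulmxN !mulmx1 opprK !addr0 !add0r.
by rewrite -scalar_mx_block.
Qed.

Lemma hyperbolicE n (Q P : 'M[K]_(n, k)) : B Q Q = 0 -> B P P = 0 ->
  B P Q = 1%:M -> B (col_mx Q P) (col_mx Q P) = std_symplectic n.
Proof. by move=> QQ PP PQ; rewrite Bcol QQ PP PQ (Btr Q P) PQ trmx1. Qed.

Lemma hyperbolic_le n : hyperbolic n -> (n <= k)%N.
Proof.
move=> [Q [P [_ _ PQ]]]; apply: (@mulmx1_min _ n k P (M *m Q^T)).
by rewrite mulmxA.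
Qed.

(** A hyperbolic pair orthogonal to the previous ones enlarges the system. *)
Lemma hyperbolicS n (Q P : 'M[K]_(n, k)) (q p : 'rV[K]_k) :
  B Q Q = 0 -> B P P = 0 -> B P Q = 1%:M ->
  B q (col_mx Q P) = 0 -> B p (col_mx Q P) = 0 -> B p q = 1%:M ->
  hyperbolic n.+1.
Proof.
move=> QQ PP PQ qG pG pq; rewrite -addn1.
have split0 (u : 'rV_k) : B u (col_mx Q P) = 0 -> B u Q = 0 /\ B u P = 0.
  rewrite /B tr_col_mx mul_mx_row -[0]row_mx0 => /eq_row_mx[-> ->].
  by [].
have [qQ qP] := split0 _ qG; have [pQ pP] := split0 _ pG.
exists (col_mx Q q), (col_mx P p); rewrite !Bcol.
rewrite QQ PP PQ pq !Bself qQ pP pQ (Btr Q q) (Btr P p) (Btr P q) qQ qP pP.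
by rewrite !trmx0 !oppr0 -scalar_mx_block block_mx0.
Qed.

(** A maximal system of hyperbolic pairs spans a nondegenerate subspace [G]. By
    maximality the form vanishes on the orthogonal complement [N] of [G], which
    is then the radical of the form. *)
Lemma darboux : exists n m,
  [/\ (n + n + m)%N = k, \rank M = (n + n)%N
    & exists (W : 'M[K]_(n + n + m, k)) (V : 'M[K]_(k, n + n + m)),
      [/\ W *m V = 1%:M, V *m W = 1%:M
        & W *m M *m W^T = block_mx (std_symplectic n) 0 0 0]].
Proof.
have ex0 : exists n, `[< hyperbolic n >].
  by exists 0%N; apply/asboolP; exists 0, 0; split; apply/matrixP => -[].
case: (ex_maxnP (m := k) ex0 _) => [n /asboolP/hyperbolic_le //|n /asboolP].
move=> [Q [P [QQ PP PQ]]] nmax; exists n.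
set G := col_mx Q P; pose J := std_symplectic n.
have GJ : B G G = J by apply: hyperbolicE.
have Ju : J \in unitmx := std_symplectic_unit n.
pose N := kermx (M *m G^T).
have NG : B N G = 0 by rewrite /B -mulmxA mulmx_ker.
(* Two rows of [N] with a nonzero pairing [c] would extend the system. *)
have NN : B N N = 0.
  apply/matrixP => i j; rewrite [RHS]mxE.
  apply: contrapT => /eqP c0; set c := B N N i j in c0.
  pose p := c^-1 *: row i N; pose q := row j N.
  have rowG l : B (row l N) G = 0.
    by rewrite /B -!row_mul -/(B N G) NG row0.
  suff /nmax : `[< hyperbolic n.+1 >] by rewrite ltnn.
  apply/asboolP; apply: (hyperbolicS (q := q) (p := p) QQ PP PQ).
  - exact: rowG.
  - by rewrite /B /p -!scalemxAl -/(B _ G) rowG scaler0.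
  apply/matrixP => a b; rewrite !ord1 [RHS]mxE eqxx /B /p -!scalemxAl [LHS]mxE.
  suff -> : (row i N *m M *m q^T) 0 0 = c by rewrite mulVf.
  by rewrite -!row_mul mxE /c /B !mxE; apply: eq_bigr => l _; rewrite !mxE.
have rkG : \rank (M *m G^T) = (n + n)%N.
  apply/eqP; rewrite eqn_leq rank_leq_col /=.
  rewrite -[X in (X <= _)%N](mxrank_unit Ju) -GJ /B -mulmxA.
  exact: mxrankM_maxr.
pose m := \rank N.
have nmk : (n + n + m)%N = k.
  by rewrite /m mxrank_ker rkG subnKC // -rkG rank_leq_row.
have [Z /submxP[X ZX] Zfree] : exists2 Z : 'M_(m, k), (Z <= N)%MS & row_free Z.
  by exists (row_base N); [rewrite eq_row_base | apply: row_base_free].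
have ZG : B Z G = 0 by rewrite ZX Bl NG mulmx0.
have ZZ : B Z Z = 0.
  by rewrite ZX Bl Br NN mul0mx mulmx0.
pose W := col_mx G Z.
have WW : B W W = block_mx J 0 0 0 by rewrite Bcol GJ ZG (Btr G Z) ZG trmx0 oppr0 ZZ.
have Wfree : row_free W.
  apply/inj_row_free => v; rewrite -(hsubmxK v) mul_row_col => vW.
  have l0 : lsubmx v = 0.
    have /(congr1 (fun U => B U G)) := vW.
    rewrite /= BD !Bl GJ ZG [B 0 G]/B !mul0mx mulmx0 addr0.
    move=> /(congr1 (mulmx^~ (invmx J))).
    by rewrite mulmxK // mul0mx.
  move: vW; rewrite l0 mul0mx add0r => rZ.
  suff -> : rsubmx v = 0 by rewrite row_mx0.
  have /row_freeP[Y ZY] := Zfree.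
  by rewrite -[rsubmx v]mulmx1 -ZY mulmxA rZ mul0mx.
have /row_freeP[V WV] := Wfree.
have VW : V *m W = 1%:M.
  have /row_fullP[V' V'W] : row_full W by rewrite /row_full (eqP Wfree) nmk.
  by have <- : V' = V by rewrite -[V']mulmx1 -WV mulmxA V'W mul1mx.
have rkB : \rank (B W W) = (n + n)%N.
  by rewrite WW rank_diag_block_mx mxrank0 addn0 mxrank_unit.
exists m; split=> //; last by exists W, V.
rewrite -rkB; apply/eqP; rewrite eqn_leq; apply/andP; split.
  have {1}-> : M = V *m (B W W) *m V^T.
    by rewrite /B !mulmxA VW mul1mx -mulmxA -trmx_mul VW trmx1 mulmx1.
  exact: leq_trans (mxrankM_maxl _ _) (mxrankM_maxr _ _).
by rewrite /B; apply: leq_trans (mxrankM_maxl _ _) (mxrankM_maxr _ _).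
Qed.

End Darboux.

(** * Darboux coordinates *)

Section NormalForm.
Variables (K : fieldType) (charK0 : [pchar K] =i pred0) (A : algType K).

Lemma subalgebra_sum (S : set A) (I : finType) (F : I -> A) :
  subalgebra S -> (forall i, S (F i)) -> S (\sum_i F i).
Proof.
move=> Ss SF; have Sr := subalgebra_subring Ss.
by apply: (big_ind S) => // [|a b]; [apply: subring0 | apply: subringD].
Qed.

Lemma scalar_inj : injective (fun c : K => c%:A : A).
Proof.
move=> c c' /eqP; rewrite -subr_eq0 -scalerBl scaler_eq0 oner_eq0 orbF subr_eq0.
by move/eqP.
Qed.

Lemma bracket_suml (I : finType) (c : I -> K) (u : I -> A) v :
  bracket (\sum_i c i *: u i) v = \sum_i c i *: bracket (u i) v.
Proof.
rewrite bracketC (kder_sum (bracket_kder v)) -sumrN; apply: eq_bigr => i _.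
by rewrite (kderZ (bracket_kder v)) -scalerN -bracketC.
Qed.

Lemma bracket_sumr (I : finType) (c : I -> K) (u : I -> A) v :
  bracket v (\sum_i c i *: u i) = \sum_i c i *: bracket v (u i).
Proof.
rewrite (kder_sum (bracket_kder v)); apply: eq_bigr => i _.
by rewrite (kderZ (bracket_kder v)).
Qed.

Definition unsplit3 n m (a : ('I_n + 'I_n) + 'I_m) : 'I_(n + n + m) :=
  match a with
  | inl (inl i) => lshift m (lshift n i)
  | inl (inr i) => lshift m (rshift n i)
  | inr j => rshift (n + n) j
  end.

Lemma unsplit3_eq n m (a b : ('I_n + 'I_n) + 'I_m) :
  (unsplit3 a == unsplit3 b) = (a == b).
Proof.
by case: a b => [[i|i]|i] [[j|j]|j];
  rewrite /unsplit3 ?eq_lshift ?eq_rshift ?eq_lrshift ?eq_rlshift //.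
Qed.

Lemma unsplit3_surj n m (c : 'I_(n + n + m)) : exists a, c = unsplit3 a.
Proof.
rewrite -(splitK c); case: (split c) => [d|j] /=; last by exists (inr j).
rewrite -(splitK d); case: (split d) => [i|i] /=; first by exists (inl (inl i)).
by exists (inl (inr i)).
Qed.

Lemma std_symplectic_form n m (a b : ('I_n + 'I_n) + 'I_m) :
  block_mx (std_symplectic K n) 0 0 0 (unsplit3 a) (unsplit3 b) = weyl_form K a b.
Proof.
by case: a b => [[i|i]|i] [[j|j]|j];
  rewrite /unsplit3 /std_symplectic;
  rewrite ?(block_mxEul, block_mxEur, block_mxEdl, block_mxEdr) !mxE.
Qed.

(** Darboux coordinates for the matrix of brackets are linear combinations of the
    given coordinates, and the dual combinations of the derivations are their
    coordinate derivations. *)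
Lemma coordinates_iso k (x : 'I_k -> A) (delta : 'I_k -> A -> A) (M : 'M[K]_k) :
  (forall i, kderivation (delta i)) -> kronecker delta x ->
  (forall i j, bracket (x i) (x j) = (M i j)%:A) ->
  exists n m, [/\ (2 * n + m = k)%N, (2 * n = \rank M)%N
    & iso_weyl_poly n m (generated x)].
Proof.
move=> dd kr xx.
have MT : M^T = - M.
  apply/matrixP => i j; rewrite !mxE; apply: scalar_inj.
  by rewrite -xx bracketC xx scaleNr.
have [n [m [nmk rkM [W [V [WV VW WMW]]]]]] := darboux charK0 MT.
exists n, m; rewrite mul2n -addnn; split=> //.
pose y (a : ('I_n + 'I_n) + 'I_m) := \sum_j W (unsplit3 a) j *: x j.
pose d (a : ('I_n + 'I_n) + 'I_m) u := \sum_j V j (unsplit3 a) *: delta j u.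
have yy a b : bracket (y a) (y b) = (weyl_form K a b)%:A.
  rewrite -std_symplectic_form -WMW !mxE scaler_suml bracket_sumr; apply: eq_bigr => j _.
  rewrite bracket_suml !mxE mulr_suml scaler_suml scaler_sumr; apply: eq_bigr => i _.
  by rewrite xx !scalerA -mulrA mulrC.
have dy a b : d a (y b) = (a == b)%:R.
  rewrite eq_sym -unsplit3_eq -[RHS](scaler_nat _ 1) .
  have <- : (W *m V) (unsplit3 b) (unsplit3 a) = (unsplit3 b == unsplit3 a)%:R.
    by rewrite WV mxE.
  rewrite mxE scaler_suml; apply: eq_bigr => j _.
  rewrite (kder_sum (dd j)) (bigD1 j) //= big1 ?addr0 => [|i ij].
    by rewrite (kderZ (dd j)) kr eqxx scalerA mulrC.
  by rewrite (kderZ (dd j)) kr eq_sym (negbTE ij) scaler0.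
have -> : generated x = generated y.
  apply/seteqP; split=> u; apply=> [|i].
  - exact: generated_subalgebra.
  - have -> : x i = \sum_c V i c *: \sum_j W c j *: x j.
      under eq_bigr do rewrite scaler_sumr.
      rewrite exchange_big (bigD1 i) //= [X in _ + X]big1 ?addr0 => [|j ji].
        under eq_bigr do rewrite scalerA.
        rewrite -scaler_suml; have /matrixP/(_ i i) := VW; rewrite !mxE eqxx => ->.
        by rewrite scale1r.
      under eq_bigr do rewrite scalerA.
      rewrite -scaler_suml; have /matrixP/(_ i j) := VW.
      by rewrite !mxE eq_sym (negbTE ji) => ->; rewrite scale0r.
    apply: subalgebra_sum (generated_subalgebra _) _ => c.
    apply: subalgebraZ (generated_subalgebra _) _.
    by have [a ->] := unsplit3_surj c; apply: (@generated_gen _ _ _ y).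
  - exact: generated_subalgebra.
  apply: subalgebra_sum (generated_subalgebra _) _ => j.
  by apply: subalgebraZ (generated_subalgebra _) _; apply: generated_gen.
apply: (weyl_poly_iso yy charK0 (d := d)) => // a.
exact: kder_comb.
Qed.

End NormalForm.

(** * Dimension of spans *)

Section Spans.
Variables (K : fieldType) (A : algType K).
Implicit Types (w L : seq A).

Definition lin_span L : set A :=
  [set a | exists c : 'I_(size L) -> K, a = \sum_i c i *: L`_i].

Lemma lin_spanD L a b : lin_span L a -> lin_span L b -> lin_span L (a + b).
Proof.
move=> [c ->] [c' ->]; exists (fun i => c i + c' i).
by rewrite -big_split; apply: eq_bigr => i _; rewrite scalerDl.
Qed.

Lemma lin_spanZ L k a : lin_span L a -> lin_span L (k *: a).
Proof.
move=> [c ->]; exists (fun i => k * c i).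
by rewrite scaler_sumr; apply: eq_bigr => i _; rewrite scalerA.
Qed.

Lemma lin_span0 L : lin_span L 0.
Proof. by exists (fun=> 0); rewrite big1 // => i _; rewrite scale0r. Qed.

Lemma lin_span_mem L a : a \in L -> lin_span L a.
Proof.
rewrite -index_mem => aL; exists (fun i => (i == Ordinal aL)%:R).
rewrite (bigD1 (Ordinal aL)) //= eqxx scale1r nth_index -?index_mem //.
by rewrite big1 ?addr0 // => i /negPf ->; rewrite scale0r.
Qed.

Lemma lin_span_sum L (I : finType) (F : I -> A) :
  (forall i, lin_span L (F i)) -> lin_span L (\sum_i F i).
Proof.
move=> SF; apply: (big_ind (lin_span L)) => //; first exact: lin_span0.
exact: lin_spanD.
Qed.

Lemma lin_span_mul L L' a y : (forall b, b \in L -> lin_span L' (b * y)) ->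
  lin_span L a -> lin_span L' (a * y).
Proof.
move=> LL' [c ->]; rewrite mulr_suml; apply: lin_span_sum => i.
by rewrite -scalerAl; apply/lin_spanZ/LL'/mem_nth.
Qed.

(** The coefficients of independent vectors with respect to [L] form a matrix
    with independent rows, hence with at most as many rows as columns. *)
Lemma dim_span_le w L : (forall a, a \in w -> lin_span L a) ->
  (Defs.dim_span w <= size L)%N.
Proof.
move=> wL; apply/bigmax_leqP => J /asboolP free.
have /choice[c cE] (i : 'I_(size w)) :
    exists c : 'I_(size L) -> K, w`_i = \sum_l c l *: L`_l.
  exact/wL/mem_nth.
pose C := \matrix_(i < #|J|, l < size L) c (enum_val i) l.
suff /eqP <- : row_free C by apply: rank_leq_col.
apply/inj_row_free => v /matrixP vC.
(* The row vector [v] spread over [J]: the sum has at most one term. *)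
pose e (x : 'I_(size w)) := \sum_(i | enum_val i == x) v 0 i.
have eE i : e (enum_val i) = v 0 i.
  by rewrite /e (eq_bigl (pred1 i)) ?big_pred1_eq // => k; rewrite (inj_eq enum_val_inj).
apply/matrixP => z i; rewrite ord1 [RHS]mxE -eE; apply: free (enum_valP i).
rewrite big_enum_val; under eq_bigr do rewrite eE cE scaler_sumr.
rewrite exchange_big big1 //= => l _.
under eq_bigr do rewrite scalerA.
rewrite -scaler_suml; have := vC 0 l; rewrite !mxE.
by under eq_bigr do rewrite mxE; move=> ->; rewrite scale0r.
Qed.

(** Indexing the coefficients by the entries rather than by their positions
    avoids computing positions in lists of products. *)
Definition independent L : Prop := uniq L /\
  forall c : A -> K, \sum_(b <- L) c b *: b = 0 -> forall b, b \in L -> c b = 0.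

Lemma independent_dim_span w L :
  independent L -> {subset L <= w} -> (size L <= Defs.dim_span w)%N.
Proof.
move=> [uL iL] Lw.
pose J := [set k : 'I_(size w) | (w`_k \in L) && (index w`_k w == k)]%SET.
have JL : perm_eq L [seq w`_k | k : 'I_(size w) <- enum J].
  apply: uniq_perm => //.
    rewrite map_inj_in_uniq ?enum_uniq // => i j.
    rewrite !mem_enum !inE => /andP[_ /eqP wi] /andP[_ /eqP wj] wij.
    by apply: val_inj; rewrite /= -wi wij wj.
  move=> a; apply/idP/mapP => [aL|[k + ->]]; last by rewrite mem_enum inE => /andP[].
  have aw : (index a w < size w)%N by rewrite index_mem Lw.
  have wa : w`_(Ordinal aw) = a by rewrite nth_index ?Lw.
  exists (Ordinal aw); last by rewrite wa.
  by rewrite mem_enum inE /=; move: wa => /= ->; rewrite aL eqxx.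
have -> : size L = #|J| by rewrite (perm_size JL) size_map -cardE.
apply: (leq_bigmax_cond (F := fun J : {set 'I_(size w)} => #|J|)).
apply/asboolP => c cJ i iJ.
pose e a := if insub (index a w) is Some k then c k else 0.
have eE (k : 'I_(size w)) : k \in J -> e w`_k = c k.
  by rewrite inE /e => /andP[_ /eqP ->]; rewrite valK.
rewrite -eE //; apply: iL; last by move: iJ; rewrite inE => /andP[].
rewrite (perm_big _ JL) big_map big_enum -[RHS]cJ.
by apply: eq_bigr => k kJ; rewrite eE.
Qed.

Lemma words_mono (v : seq A) m n : (m <= n)%N -> {subset words v m <= words v n}.
Proof.
move=> /subnK <-; elim: (n - m)%N => [|k IH] a // /IH am.
by rewrite addSn /= mem_cat am.
Qed.

Lemma words_mul (v : seq A) m n a b :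
  a \in words v m -> b \in words v n -> a * b \in words v (m + n).
Proof.
move=> + bn; elim: m a => [|m IH] a /=; first by rewrite inE => /eqP ->; rewrite mul1r.
rewrite !mem_cat => /orP[/IH -> //|/allpairsP[[u a'] /= [uv am ->]]].
by rewrite -mulrA allpairs_f ?orbT // IH.
Qed.

Lemma words1 (v : seq A) n : 1 \in words v n.
Proof. by apply: (@words_mono v 0) => //; rewrite inE. Qed.

Lemma words_var (v : seq A) a : a \in v -> a \in words v 1.
Proof.
have -> : words v 1 = words v 0 ++ [seq u * b | u <- v, b <- words v 0] by [].
move=> av; rewrite mem_cat; apply/orP; right.
by rewrite -[X in X \in _]mulr1; apply: allpairs_f => //; rewrite inE.
Qed.

Lemma words_exp (v : seq A) a n : a \in v -> a ^+ n \in words v n.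
Proof.
move=> av; elim: n => [|n IH]; first by rewrite expr0 words1.
by rewrite exprS -add1n words_mul // words_var.
Qed.

End Spans.

(** * Growth of the algebra *)

Section Growth.
Variables (K : fieldType) (A : algType K).
Hypothesis charK0 : [pchar K] =i pred0.
Variables (s : nat) (delta : 'I_s -> A -> A) (x : 'I_s -> A).
Hypotheses (lnd : lnd_family delta) (kr : kronecker delta x).
Let dd := lnd_der lnd.
Local Notation constants := (constants delta).

(** The polynomials of degree less than [N] in each variable; in this form the
    behaviour under products is just Leibniz' rule. *)
Definition bounded N : set A := [set a | forall i, iter N (delta i) a = 0].

Lemma boundedM m n a b : bounded m a -> bounded n b -> bounded (m + n) (a * b).
Proof. by move=> am bn i; apply: kder_iterM_eq0. Qed.

Lemma bounded_mono m n a : (m <= n)%N -> bounded m a -> bounded n a.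
Proof. by move=> /subnK <- am i; rewrite iterD am kder_iter0. Qed.

Lemma bounded1 : bounded 1 1.
Proof. by move=> i; apply: (kder1 (dd i)). Qed.

Lemma bounded_ex a : exists N, bounded N a.
Proof.
have /choice[k kP] i : exists k, iter k (delta i) a = 0 := lnd_nilp lnd i a.
exists (\max_i k i) => i; have /subnK <- := @leq_bigmax _ k i.
by rewrite iterD kP kder_iter0.
Qed.

Lemma bounded_seq (v : seq A) : exists N, forall a, a \in v -> bounded N a.
Proof.
elim: v => [|b v [N vN]]; first by exists 0%N.
have [M bM] := bounded_ex b; exists (maxn M N) => a.
rewrite inE => /orP[/eqP ->|/vN aN].
  exact: bounded_mono (leq_maxl _ _) bM.
exact: bounded_mono (leq_maxr _ _) aN.
Qed.

Lemma bounded_words v N n a : (forall b, b \in v -> bounded N b) ->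
  a \in words v n -> bounded (n * N).+1 a.
Proof.
move=> vN; elim: n a => [|n IH] a /=; first by rewrite inE => /eqP ->; apply: bounded1.
rewrite mem_cat => /orP[/IH|/allpairsP[[u b] /= [/vN uN /IH bn ->]]].
  by apply: bounded_mono; rewrite ltnS leq_mul2r leqnSn orbT.
by rewrite mulSn -addnS; apply: boundedM.
Qed.

Fixpoint monomials N (l : seq 'I_s) : seq A :=
  if l is i :: l' then [seq b * x i ^+ e | b <- monomials N l', e <- iota 0 N]
  else [:: 1].

Lemma size_monomials N l : size (monomials N l) = (N ^ size l)%N.
Proof. by elim: l => //= i l IH; rewrite size_allpairs IH size_iota expnSr. Qed.

Lemma kder_iter_coef j i (r : A) e n : j != i ->
  iter n (delta j) (r * x i ^+ e) = iter n (delta j) r * x i ^+ e.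
Proof.
move=> ji; have dx0 : delta j (x i ^+ e) = 0.
  elim: e => [|e IH]; first exact: kder1.
  by rewrite exprS (kderM (dd j)) IH (kronecker_kder0 kr) // mul0r mulr0 addr0.
by elim: n => //= n ->; rewrite (kderM (dd j)) dx0 mulr0 addr0.
Qed.

Lemma kder_iter_sum j n (I : finType) (F : I -> A) :
  iter n (delta j) (\sum_i F i) = \sum_i iter n (delta j) (F i).
Proof.
by apply: (big_morph _ (kder_iterD n (dd j)) (kder_iter0 n (dd j))).
Qed.

(** The bound on [a] is inherited by its Taylor coefficients, as [delta_j] with
    [j != i] acts on the sums of powers of [x_i] coefficientwise. *)
Lemma bounded_span N l a : uniq l -> constants (mem l) a -> bounded N a ->
  lin_span (monomials N l) a.
Proof.
elim: l a => [|i l IH] a /=.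
  move=> _ aC _; have [k _ <-] : scalars a.
    by rewrite -(constants0 lnd) => j _; apply: aC.
  by apply/lin_spanZ/lin_span_mem; rewrite inE.
move=> /andP[il ul] aC aN.
have aC' : constants (predU1 i (mem l)) a by move=> j jP; apply: aC; rewrite /= inE.
have [r rC aE] := constants_expand charK0 lnd kr il aC' (aN i).
rewrite aE; apply: lin_span_sum => e.
apply: (lin_span_mul (L := monomials N l)) => [b bL|].
  by apply: lin_span_mem; apply: allpairs_f => //; rewrite mem_iota /=.
apply: IH => // j; have [->|ji] := eqVneq j i.
  have iter0 M : (0 < M)%N -> iter M (delta i) (r e) = 0.
    by case: M => // M _; rewrite iterSr rC // kder_iter0.
  exact/iter0/(leq_ltn_trans (leq0n e)).
apply: (kder_coefs_eq0 charK0 (dd i) (kronecker_kder1 i kr)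
  (r := fun e => iter N (delta j) (r e))) (ltn_ord e) => [k|].
  elim: (N) => [|M IHM]; first exact: rC.
  by rewrite iterS (lnd_comm lnd) IHM (kder0 (dd j)).
rewrite -[RHS](aN j) aE kder_iter_sum; apply: eq_bigr => k _.
by rewrite kder_iter_coef.
Qed.

(** Differentiation with respect to the last variable reduces a linear relation
    to relations between the coefficients of its powers. *)
Lemma monomials_independent N l : uniq l ->
  independent (monomials N l) /\ forall b, b \in monomials N l -> constants (mem l) b.
Proof.
elim: l => [|i l IH] /=.
  move=> _; split=> [|b]; last by rewrite inE => /eqP -> j _; apply: kder1.
  split=> // c; rewrite big_seq1 => /eqP.
  by rewrite scaler_eq0 oner_eq0 orbF => /eqP c1 b; rewrite inE => /eqP ->.
move=> /andP[il ul]; have [[uL iL] LC] := IH ul.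
set L := monomials N l in uL iL LC *.
have Li b : b \in L -> delta i b = 0 by move=> /LC; apply.
have coef (c : A -> nat -> K) :
    \sum_(b <- L) \sum_(e < N) c b e *: (b * x i ^+ e) = 0 ->
    forall b e, b \in L -> (e < N)%N -> c b e = 0.
  move=> s0 b e bL eN; apply: (iL (c^~ e)) bL.
  apply: (kder_coefs_eq0 charK0 (dd i) (kronecker_kder1 i kr)
    (r := fun e => \sum_(b <- L) c b e *: b)) eN => [k|].
    rewrite (kder_sum (dd i)) big_seq big1 // => b' b'L.
    by rewrite (kderZ (dd i)) Li // scaler0.
  rewrite -[RHS]s0 exchange_big; apply: eq_bigr => k _.
  by rewrite mulr_suml; apply: eq_bigr => b' _; rewrite scalerAl.
have inj b b' e e' : b \in L -> b' \in L -> (e < N)%N -> (e' < N)%N ->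
    b * x i ^+ e = b' * x i ^+ e' -> (b, e) = (b', e').
  move=> bL b'L eN e'N E; apply/eqP/negPn/negP => ne.
  pose c a k : K := ((a, k) == (b, e))%:R - ((a, k) == (b', e'))%:R.
  have := coef c _ b e bL eN; rewrite /c eqxx (negbTE ne) subr0 => c0.
  have /eqP : (1 : K) = 0; last by rewrite oner_eq0.
  apply: c0; have pick b0 e0 : b0 \in L -> (e0 < N)%N ->
      \sum_(a <- L) \sum_(k < N) ((a, k : nat) == (b0, e0))%:R *: (a * x i ^+ k)
      = b0 * x i ^+ e0.
    move=> b0L e0N; rewrite (bigD1_seq b0) //= (bigD1 (Ordinal e0N)) //= eqxx scale1r.
    rewrite big1 ?addr0 => [|k /negPf kE].
      rewrite big1 ?addr0 // => a /negPf ab; rewrite big1 // => k _.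
      by rewrite xpair_eqE ab scale0r.
    rewrite xpair_eqE eqxx /=; suff -> : (k == e0 :> nat) = false by rewrite scale0r.
    by rewrite -kE.
  under eq_bigr => a _ do under eq_bigr => k _ do rewrite scalerBl.
  under eq_bigr => a _ do rewrite sumrB.
  by rewrite sumrB !pick // E subrr.
split=> [|_ /allpairsP[[b e] /= [bL _ ->]] j].
  split.
    rewrite allpairs_uniq ?iota_uniq // => -[b e] [b' e'] /=.
    move=> /allpairsP[[? ?] /= [bL + [-> ->]]] /allpairsP[[? ?] /= [b'L + [-> ->]]].
    by rewrite !mem_iota /= => eN e'N; apply: inj.
  move=> c s0 _ /allpairsP[[b e] /= [bL + ->]]; rewrite mem_iota /= => eN.
  apply: (coef (fun b e => c (b * x i ^+ e))) => //.
  rewrite -[RHS]s0 big_allpairs_dep /=; apply: eq_bigr => b' _.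
  pose F k := c (b' * x i ^+ k) *: (b' * x i ^+ k).
  by rewrite -(big_mkord xpredT F) /index_iota subn0.
rewrite /= inE negb_or => /andP[ji jl].
by have := kder_iter_coef b e 1 ji => /= ->; rewrite LC // mul0r.
Qed.

Lemma monomials_words N l :
  {subset monomials N l <= words [seq x i | i <- enum 'I_s] (size l * N)}.
Proof.
elim: l => [|i l IH] b //= /allpairsP[[a e] /= [/IH al + ->]].
rewrite mem_iota /= add0n => eN; rewrite mulSn addnC; apply: words_mul => //.
apply: (words_mono (ltnW eN)); apply: words_exp.
by apply: map_f; rewrite mem_enum.
Qed.

(** If a finite set has degree less than [N] in each variable, its products of
    [n] factors have degree at most [n * N]. *)
Lemma dim_words_le (v : seq A) :
  exists N, forall n, (Defs.dim_span (words v n) <= (n * N).+1 ^ s)%N.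
Proof.
have [N vN] := bounded_seq v; exists N => n.
rewrite -[X in (_ ^ X)%N](size_enum_ord s).
rewrite -size_monomials; apply: dim_span_le => a /(bounded_words vN) aN.
apply: bounded_span aN; first exact: enum_uniq.
by move=> j; rewrite /= mem_enum.
Qed.

(** Monomials of degree less than [n %/ s] in each of the [s] variables are
    products of at most [n] variables. *)
Lemma dim_words_ge n :
  ((n %/ s) ^ s <= Defs.dim_span (words [seq x i | i <- enum 'I_s] n))%N.
Proof.
rewrite -[X in (_ ^ X)%N](size_enum_ord s).
rewrite -size_monomials; apply: independent_dim_span.
  by have [] := monomials_independent (n %/ s) (enum_uniq 'I_s).
move=> a /monomials_words; apply: words_mono.
by rewrite size_enum_ord mulnC leq_trunc_div.
Qed.

End Growth.

(** * Gelfand-Kirillov dimension from polynomial growth *)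

Section GrowthRate.
Variable RR : realType.
Implicit Types (u : nat -> RR) (l e C : RR).

Lemma limn_esup_le u l :
  (forall e, 0 < e -> exists N, forall n, (N <= n)%N -> u n <= l + e) ->
  (limn_esup (fun n => (u n)%:E) <= l%:E)%E.
Proof.
move=> ul; apply/lee_addgt0Pr => e /ul[N uN].
have AN : \oo [set n | (N <= n)%N] by exists N.
apply: le_trans (ereal_inf_lbound _) _; first by exists [set n | (N <= n)%N].
by apply: ge_ereal_sup => _ [n nN <-]; rewrite -EFinD lee_fin uN.
Qed.

Lemma limn_esup_ge u l :
  (forall e, 0 < e -> exists N, forall n, (N <= n)%N -> l <= u n + e) ->
  (l%:E <= limn_esup (fun n => (u n)%:E))%E.
Proof.
move=> ul; apply: le_ereal_inf_tmp => _ [B [M _ MB] <-].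
apply/lee_addgt0Pr => e /ul[N uN].
have Bn : B (maxn M N) by apply: MB; rewrite /= leq_maxl.
apply: (@le_trans _ _ ((u (maxn M N))%:E + e%:E)%E).
  by rewrite -EFinD lee_fin uN // leq_maxr.
by rewrite leeD2r //; apply: ereal_sup_ubound; exists (maxn M N).
Qed.

(** Additive constants do not matter in the growth exponent. *)
Lemma ln_dominates C e : 0 < e ->
  exists N, forall n, (N <= n)%N -> [/\ (1 < n)%N, 0 < ln (n%:R : RR) & C <= e * ln n%:R].
Proof.
move=> e0; exists (Num.bound (expR (C / e))).+2 => n nN.
have n1 : (1 < n)%N by apply: leq_trans nN.
have n0 : (n%:R : RR) \in Num.pos by rewrite posrE ltr0n ltnW.
split=> //; first by rewrite ln_gt0 // ltr1n.
rewrite mulrC -ler_pdivrMr // -ler_expR lnK //.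
apply/ltW/(lt_le_trans (archi_boundP (expR_ge0 _))).
by rewrite ler_nat; apply: leq_trans nN; rewrite -addn2 leq_addr.
Qed.

Lemma ln_natM (m n : nat) : (0 < m)%N -> (0 < n)%N ->
  ln ((m * n)%N%:R : RR) = ln m%:R + ln n%:R.
Proof. by move=> m0 n0; rewrite natrM lnM // posrE ltr0n. Qed.

Lemma ln_natX (m s : nat) : (0 < m)%N -> ln ((m ^ s)%N%:R : RR) = s%:R * ln m%:R.
Proof. by move=> m0; rewrite natrX lnXn ?ltr0n // mulr_natl. Qed.

Lemma ln_nat_le (m n : nat) : (0 < m)%N -> (m <= n)%N ->
  ln (m%:R : RR) <= ln n%:R.
Proof.
move=> m0 mn; rewrite ler_ln ?ler_nat // posrE ltr0n //.
exact: leq_trans mn.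
Qed.

(** For large [n], the logarithm of the dimension lies between
    [s * (ln n - ln (2 * s))] and [s * (ln n + ln N.+1)]. *)
Lemma GKdim_polynomial_growth (K : fieldType) (A : algType K) (s : nat) :
  (0 < s)%N ->
  (forall v : seq A, exists N, forall n,
     (Defs.dim_span (words v n) <= (n * N).+1 ^ s)%N) ->
  (exists v : seq A, forall n, ((n %/ s) ^ s <= Defs.dim_span (words v n))%N) ->
  GKdim A RR = s%:R%:E.
Proof.
move=> s0 up [v low]; apply/eqP; rewrite eq_le; apply/andP; split.
  apply: ge_ereal_sup => _ [w _ <-]; apply: limn_esup_le => e e0.
  have [N wN] := up w.
  have [M lnM] := ln_dominates (s%:R * ln N.+1%:R) e0; exists M => n /lnM[n1 ln0 Cn].
  rewrite ler_pdivrMr // mulrDl.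
  have n0 : (0 < n)%N by apply: ltnW.
  have [->|D0] := posnP (Defs.dim_span (words w n)).
    rewrite (@exp.ln0 RR 0%:R) //; apply: addr_ge0; apply: mulr_ge0 => //; exact: ltW.
  apply: le_trans (ln_nat_le D0 (wN n)) _; rewrite ln_natX //.
  apply: (@le_trans _ _ (s%:R * ln (n * N.+1)%:R)).
    by rewrite ler_wpM2l // ln_nat_le // mulnS addnC -addn1 leq_add2l.
  by rewrite ln_natM // mulrDr lerD2l.
apply: (@le_trans _ _ (limn_esup (fun n =>
    ((ln (Defs.dim_span (words v n))%:R / ln n%:R)%:E : \bar RR)))); last first.
  by apply: ereal_sup_ubound; exists v.
apply: limn_esup_ge => e e0.
have [M lnM] := ln_dominates (s%:R * ln (2 * s)%:R) e0; exists (maxn M s) => n.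
rewrite geq_max => /andP[/lnM[n1 ln0 Cn] sn].
have q0 : (0 < n %/ s)%N by rewrite divn_gt0.
(* The truncated quotient loses at most a factor two once [s <= n]. *)
have nq : (n <= n %/ s * (2 * s))%N.
  rewrite mulnCA mul2n -addnn {1}(divn_eq n s) leq_add2l.
  by apply: leq_trans (ltnW (ltn_pmod n s0)) _; rewrite leq_pmull.
rewrite -lerBlDr ler_pdivlMr // mulrBl.
apply: (@le_trans _ _ (s%:R * ln (n %/ s)%:R)); last first.
  by rewrite -ln_natX //; apply: ln_nat_le (low n); rewrite expn_gt0 q0.
have := ln_nat_le (ltnW n1) nq; rewrite ln_natM ?muln_gt0 ?s0 // => nle.
rewrite lerBlDr; apply: le_trans (ler_wpM2l _ nle) _ => //.
by rewrite mulrDr lerD2l.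
Qed.

End GrowthRate.

(** * The equivalences and their consequences *)

Section Equivalence.
Variables (K : fieldType) (charK0 : [pchar K] =i pred0) (A : algType K) (s : nat).

Lemma cond_lnd_ore : cond_lnd A s -> cond_ore A s.
Proof.
move=> [delta lnd]; have [x kr] := lnd_coordinates lnd.
by have [d [lambda fam]] := lnd_ore_family charK0 lnd kr; exists x, d, lambda, delta.
Qed.

Lemma ore_family_coordinates x d lambda (delta : 'I_s -> A -> A) :
  ore_family x d lambda delta ->
  forall i j, bracket (x i) (x j) = (antisym_mx lambda i j)%:A.
Proof. by move=> [io _ _]; apply: iter_ore_bracket_mx io. Qed.

Lemma cond_ore_lnd : cond_ore A s -> cond_lnd A s.
Proof.
move=> [x [d [lambda [delta fam]]]]; have [io dd kr] := fam; exists delta.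
apply: (lnd_of_generators charK0 dd kr (ore_family_coordinates fam)).
exact: iter_ore_generated io.
Qed.

Lemma ore_family_weyl x d lambda (delta : 'I_s -> A -> A) :
  ore_family x d lambda delta ->
  exists n m, [/\ (2 * n + m = s)%N, (2 * n = \rank (antisym_mx lambda))%N
    & iso_weyl_poly n m [set: A]].
Proof.
move=> fam; have [io dd kr] := fam; rewrite -(iter_ore_generated io).
exact: (coordinates_iso charK0 dd kr (ore_family_coordinates fam)).
Qed.

Lemma cond_weyl_lnd : cond_weyl A s -> cond_lnd A s.
Proof.
by move=> [n [m [nms [f [fl fm fI fT]]]]]; apply: (iso_weyl_poly_lnd charK0 fl fm fI fT).
Qed.

Variables (delta : 'I_s -> A -> A) (x : 'I_s -> A) (d : 'I_s -> A -> A).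
Variable lambda : 'I_s -> 'I_s -> K.
Hypotheses (lnd : lnd_family delta) (fam : ore_family x d lambda delta).

Lemma derker_constants i :
  derker (delta i) = constants delta (mem [seq j <- enum 'I_s | j != i]).
Proof.
apply/seteqP; split=> a /= ai => [j|].
  by rewrite /= mem_filter mem_enum andbT negbK => /eqP ->.
by apply: ai; rewrite /= mem_filter eqxx.
Qed.

Lemma derker_iter_ore i :
  scalar_iter_ore x d lambda [seq j <- enum 'I_s | j != i] (derker (delta i)).
Proof.
have [io dd kr] := fam; rewrite derker_constants.
apply: (constants_scalar_iter_ore charK0 lnd kr).
- exact/pairwise_filter/enum_ord_pairwise.
- by move=> k r; apply: (iter_ore_constants charK0 io lnd kr).
- exact: iter_ore_bracket io.
Qed.

Lemma derker_weyl i : exists m l,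
  (2 * m + l = s.-1)%N /\ iso_weyl_poly m l (derker (delta i)).
Proof.
have [io dd kr] := fam; rewrite derker_constants.
set l := [seq j <- enum 'I_s | j != i].
have ul : uniq l by rewrite filter_uniq // enum_uniq.
have sl : size l = s.-1.
  have := count_predC (pred1 i) (enum 'I_s).
  rewrite count_uniq_mem ?enum_uniq // mem_enum size_enum_ord => /(congr1 predn) <-.
  by rewrite size_filter.
rewrite (constants_generated charK0 lnd kr ul) -sl.
have [|||n [m [nm _ iso]]] := coordinates_iso charK0
    (x := fun k : 'I_(size l) => x (tnth (in_tuple l) k))
    (delta := fun k => delta (tnth (in_tuple l) k))
    (M := \matrix_(j, k) antisym_mx lambda (tnth (in_tuple l) j) (tnth (in_tuple l) k)).
- by move=> k; apply: dd.
- move=> j k; rewrite kr; congr (_%:R).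
  by have /tuple_uniqP/inj_eq -> : uniq (in_tuple l) by [].
- by move=> j k; rewrite mxE; apply: ore_family_coordinates fam _ _.
by exists n, m.
Qed.

(** The rank of the bracket matrix is read off from the presentation that Darboux
    coordinates give; all presentations have the same [m]. *)
Lemma iso_weyl_poly_rank n m : (2 * n + m = s)%N -> iso_weyl_poly n m [set: A] ->
  [/\ (2 * n = \rank (antisym_mx lambda))%N, (m = s - 2 * n)%N &
      m = \rank (kermx (antisym_mx lambda))].
Proof.
move=> nms iso; have [n' [m' [nms' rk iso']]] := ore_family_weyl fam.
have mm := iso_weyl_poly_unique charK0 iso iso'; subst m'.
have nn : (2 * n = 2 * n')%N by apply: (@addIn m); rewrite nms nms'.
by rewrite mxrank_ker -rk -nn; split=> //; rewrite -nms addKn.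
Qed.

Lemma GKdim_lnd (RR : realType) : (0 < s)%N -> GKdim A RR = (s%:R)%:E.
Proof.
have [io dd kr] := fam => s_gt0; apply: GKdim_polynomial_growth => //.
  by move=> v; apply: (dim_words_le charK0 lnd kr).
by exists [seq x i | i <- enum 'I_s] => n; apply: (dim_words_ge charK0 lnd kr).
Qed.

End Equivalence.

Theorem theorem5p3 (RR : realType) (K : fieldType) (charK0 : [pchar K] =i pred0)
    (A : algType K) (s : nat) (s_gt0 : (0 < s)%N) :
  ((cond_lnd A s <-> cond_ore A s) /\ (cond_ore A s <-> cond_weyl A s)) /\
  forall (delta : 'I_s -> A -> A) (x : 'I_s -> A) (d : 'I_s -> A -> A)
      (lambda : 'I_s -> 'I_s -> K),
    lnd_family delta -> ore_family x d lambda delta ->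
    [/\ forall y : 'I_s -> A, kronecker delta y <->
          exists c : 'I_s -> K, forall j, y j = x j + (c j)%:A,
        forall n m : nat, (2 * n + m = s)%N -> iso_weyl_poly n m [set: A] ->
          [/\ (2 * n = \rank (antisym_mx lambda))%N, (m = s - 2 * n)%N &
              m = \rank (kermx (antisym_mx lambda))],
        forall i : 'I_s,
          scalar_iter_ore x d lambda [seq j <- enum 'I_s | j != i]
            (derker (delta i)) /\
          exists m l : nat,
            (2 * m + l = s.-1)%N /\ iso_weyl_poly m l (derker (delta i)) &
        GKdim A RR = (s%:R)%:E].
Proof.
split.
  split; split; [exact: cond_lnd_ore | exact: cond_ore_lnd | | ].
    move=> [x [d [lambda [delta fam]]]].
    by have [n [m [nms _ iso]]] := ore_family_weyl charK0 fam; exists n, m.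
  by move=> /(cond_weyl_lnd charK0)/(cond_lnd_ore charK0).
move=> delta x d lambda lnd fam; have [_ _ kr] := fam; split.
- by move=> y; apply: (kronecker_unique lnd kr).
- by move=> n m; apply: (iso_weyl_poly_rank charK0 fam).
- move=> i; split; first apply: (derker_iter_ore charK0 lnd fam).
  apply: (derker_weyl charK0 lnd fam).
- apply: (GKdim_lnd charK0 lnd fam RR s_gt0).
Qed.
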